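(* Let $T$ be a tree on $n\ge 4$ vertices, let $v_1$ and $v_c$ be two non-adjacent vertices of $T$, let $v_1,v_2,\dots,v_c$ be the unique path in $T$ from $v_1$ to $v_c$ (so $c\ge3$), and let $G$ be the graph obtained from $T$ by adding the edge $v_1v_c$. Then $$\begin{aligned}\mathcal{K}(G)-\mathcal{K}(T)\le \frac{1}{4cn(n-1)}\Big\{&4c\cdot\tfrac{2}{3}(n-c+1)(n-c)(n-c-1)\\ &-8(n-c)\Big(-nc\left\lfloor\tfrac{c+1}{2}\right\rfloor\left\lceil\tfrac{c+1}{2}\right\rceil+\tfrac{c(c+1)}{6}\big((2n+1)c+n-1\big)\Big)\\ &-\tfrac{4(n+1)c^2(c^2-1)}{6}+4n(n-1)c(c-1)+2(n-1)c^2\Big\}.\end{aligned}$$ Moreover, equality holds if and only if $T$ is the tree obtained by identifying an end vertex of a path on $n-c+1$ vertices with the middle vertex (or one of the two middle vertices if $c$ is even) of the path $v_1,v_2,\dots,v_c$.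
   Context: Kemeny's constant: for a connected graph $H$ with adjacency matrix $A$ and diagonal degree matrix $\Delta$, consider the random walk with transition matrix $\Delta^{-1}A$, its stationary distribution $w=(w_k)$ and mean first passage times $m_{j,k}$; then $\mathcal{K}(H)=\sum_{k\neq j} m_{j,k}w_k$, which is independent of $j$. *)

(* Defs.v *)
From HB Require Import structures.
From mathcomp Require Import all_boot all_order all_algebra.
From mathcomp Require Import all_classical all_reals all_analysis.
Set Implicit Arguments. Unset Strict Implicit. Unset Printing Implicit Defensive.
Import Order.TTheory GRing.Theory Num.Theory.
Local Open Scope ring_scope.

(* A (simple) graph on a finite vertex type V is a symmetric, irreflexive
   relation e : rel V. *)

Section Graphs.
Variables (V : finType).

Definition connected_graph (e : rel V) : Prop := forall x y : V, connect e x y.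

Definition acyclic_graph (e : rel V) : Prop :=
  forall s : seq V, uniq s -> (3 <= size s)%N -> ~~ cycle e s.

Definition is_tree (e : rel V) : Prop := connected_graph e /\ acyclic_graph e.

Definition add_edge (e : rel V) (a b : V) : rel V :=
  [rel x y | e x y || ((x == a) && (y == b)) || ((x == b) && (y == a))].

Definition path_edge (s : seq V) (x y : V) : bool :=
  has (fun i => [&& (nth x s i == x), (nth x s i.+1 == y) & (i.+1 < size s)%N]
             || [&& (nth x s i == y), (nth x s i.+1 == x) & (i.+1 < size s)%N])
      (iota 0 (size s)).
End Graphs.

Section RandomWalk.
Variables (R : realType) (V : finType) (e : rel V).

Definition deg (x : V) : nat := #|[set y | e x y]|.

Definition trans (x y : V) : R := (e x y)%:R / (deg x)%:R.

Definition stationary (w : V -> R) : Prop :=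
  [/\ forall k, 0 <= w k, \sum_(k : V) w k = 1 &
      forall k, \sum_(j : V) w j * trans j k = w k].

(* first_hit k t j = probability that the walk started at j first visits k
   at time t (t >= 1): first_hit k 1 j = P_{jk},
   first_hit k (t+1) j = sum_{l <> k} P_{jl} first_hit k t l. *)
Fixpoint first_hit (k : V) (t : nat) (j : V) : R :=
  match t with
  | 0 => 0
  | 1 => trans j k
  | t'.+1 => \sum_(l : V | l != k) trans j l * first_hit k t' l
  end.

Definition mfpt (j k : V) : R := \big[+%R/0]_(1 <= t <oo) (t%:R * first_hit k t j).

Definition kemeny (w : V -> R) (j : V) : R :=
  \sum_(k : V | k != j) mfpt j k * w k.
End RandomWalk.

Definition bound31 (R : realType) (n c : nat) : R :=
  let nR : R := n%:R in let cR : R := c%:R in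
  let fl : R := ((c.+1)./2)%:R in let cl : R := ((c.+2)./2)%:R in
  (4 * cR * nR * (nR - 1))^-1 *
  ( 4 * cR * (2 / 3) * (nR - cR + 1) * (nR - cR) * (nR - cR - 1)
    - 8 * (nR - cR) * (- nR * cR * fl * cl
                       + cR * (cR + 1) / 6 * ((2 * nR + 1) * cR + nR - 1))
    - 4 * (nR + 1) * cR ^+ 2 * (cR ^+ 2 - 1) / 6
    + 4 * nR * (nR - 1) * cR * (cR - 1)
    + 2 * (nR - 1) * cR ^+ 2 ).

(* Main.v *)
(* For a function r on pairs of vertices whose rows satisfy
   L r(.,k) = tau - 2 delta_k (L the Laplacian), the hitting times are
   H(j,k) = (1/2) sum_z d_z (r_jk + r_kz - r_jz), so that Kemeny's constant is
   (sum_{k,z} d_k d_z r_kz) / (2 sum_z d_z). On the tree r is the distance; adding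
   the edge v_1 v_c replaces it by r - (phi_x - phi_y)^2 / (4c), where
   phi_x = r(x,v_1) - r(x,v_c).
   Root T at v_1 and write z <= x when z lies on the path from v_1 to x. Let O
   be the set of the k = n - c vertices off the path v_1 .. v_c, and level x the
   index of the projection of x on this path. After expansion of both constants,
   n (n-1) (bound - (K(G) - K(T))) is the sum of three nonnegative terms:
   - 2 ((k^3 - k)/3 - M), where M counts the triples (z,x,y) in O with x <> y and
     z <= x, z <= y; it vanishes iff O is a chain;
   - a sum over x in O that vanishes iff every x in O projects on a middle vertex;
   - a sum over pairs in O that vanishes iff all of O projects on one vertex. *)
Require Import Defs.
From HB Require Import structures.
From mathcomp Require Import all_boot all_order all_algebra.
From mathcomp Require Import all_classical all_reals all_analysis.
From mathcomp Require Import ring lra zify.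
Set Implicit Arguments. Unset Strict Implicit. Unset Printing Implicit Defensive.
Import Order.TTheory GRing.Theory Num.Theory.
Import numFieldNormedType.Exports.
Local Open Scope ring_scope.

(** * Hitting times and Kemeny's constant from a resistance function *)

Section Sums.
Variables (R : realType) (V : finType).

Lemma sum_indl (x : V) (F : V -> R) : \sum_y (x == y)%:R * F y = F x.
Proof.
rewrite (bigD1 x) //= eqxx mul1r big1 ?addr0 // => y /negbTE yx.
by rewrite eq_sym yx mul0r.
Qed.

Lemma sum_indr (x : V) (F : V -> R) : \sum_y (y == x)%:R * F y = F x.
Proof. by under eq_bigr do rewrite eq_sym; exact: sum_indl. Qed.

Lemma sum_ind1 (x : V) : \sum_y ((y == x)%:R : R) = 1.
Proof. by rewrite -[RHS](sum_indr x (fun=> 1)); apply: eq_bigr => y _; rewrite mulr1. Qed.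

End Sums.

Section Laplacian.
Variables (R : realType) (V : finType) (e : rel V).
Hypothesis e_sym : symmetric e.

Definition lap (g : V -> R) (j : V) : R := \sum_l (e j l)%:R * (g j - g l).

Lemma degE j : (deg e j)%:R = \sum_l (e j l)%:R :> R.
Proof.
rewrite /deg cardsE -sum1_card natr_sum big_mkcond /=.
by apply: eq_bigr => l _; rewrite unfold_in; case: (e j l).
Qed.

Lemma lapE g j : lap g j = (deg e j)%:R * g j - \sum_l (e j l)%:R * g l.
Proof. by rewrite degE mulr_suml -sumrB; apply: eq_bigr => l _; rewrite mulrBr. Qed.

Lemma lap_selfadjoint u g : \sum_j u j * lap g j = \sum_j g j * lap u j.
Proof.
under eq_bigr do rewrite lapE mulrBr mulr_sumr.
under [RHS]eq_bigr do rewrite lapE mulrBr mulr_sumr.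
rewrite !sumrB; congr (_ - _); first by apply: eq_bigr => j _; ring.
rewrite exchange_big /=; apply: eq_bigr => j _; apply: eq_bigr => l _.
by rewrite (e_sym l j); ring.
Qed.

Lemma sum_lap g : \sum_j lap g j = 0.
Proof.
have := lap_selfadjoint (fun=> 1) g; under eq_bigr do rewrite mul1r.
move=> ->; rewrite big1 // => j _; rewrite /lap big1 ?mulr0 // => l _.
by rewrite subrr mulr0.
Qed.

(* The relation between the Laplacian and the resistance matrix; any [r]
   satisfying it plays the role of the resistance distance. *)
Definition resistance (r : V -> V -> R) (tau : V -> R) : Prop :=
  (forall k, r k k = 0) /\
  forall j k, lap (r^~ k) j = tau j - 2 * (j == k)%:R.

Section Resistance.
Variables (r : V -> V -> R) (tau : V -> R).
Hypothesis r_res : resistance r tau.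

(** Pairing [u] with the column [r^~ k] and moving the Laplacian onto [u] gives
    [0 = \sum_j u j * tau j - 2 * u k], and the first term does not depend on [k]. *)
Lemma harmonic_const u : (forall j, lap u j = 0) -> forall k l, u k = u l.
Proof.
move=> u0.
suff E k : u k = (\sum_j u j * tau j) / 2 by move=> k l; rewrite !E.
have := lap_selfadjoint u (r^~ k).
rewrite [RHS]big1 => [|j _]; last by rewrite u0 mulr0.
have -> : \sum_j u j * lap (r^~ k) j = \sum_j (u j * tau j) - 2 * u k.
  rewrite -(sum_indr k u) mulr_sumr -sumrB.
  by apply: eq_bigr => j _; rewrite r_res.2; ring.
by move=> /eqP; rewrite subr_eq0 => /eqP ->; field.
Qed.

(** A Laplacian sums to zero, so [u] is harmonic at [k] too and hence constant. This is the
    uniqueness principle behind both first-step equations below. *)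
Lemma harmonic_off_eq0 u k :
  (forall j, j != k -> lap u j = 0) -> u k = 0 -> forall j, u j = 0.
Proof.
move=> u0 uk j; rewrite -uk; apply: harmonic_const => {}j.
have [->|] := eqVneq j k; last exact: u0.
have := sum_lap u; rewrite (bigD1 k) //= big1 ?addr0 // => l; exact: u0.
Qed.

Hypothesis deg_gt0 : forall j, (0 < deg e j)%N.

Let dR j : R := (deg e j)%:R.

Let dR_gt0 j : 0 < dR j. Proof. by rewrite ltr0n. Qed.

Let dR_neq0 j : dR j != 0. Proof. by rewrite gt_eqF. Qed.

Lemma sum_deg_gt0 (k : V) : 0 < \sum_j dR j.
Proof.
by rewrite (bigD1 k) //= ltr_pwDl // sumr_ge0 // => i _; exact: ltW.
Qed.

(** By symmetry of [e], stationarity says that [w j / dR j] is harmonic, hence constant; the total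
    mass 1 fixes the constant. *)
Lemma stationaryE w : stationary e w -> forall k, w k = dR k / \sum_j dR j.
Proof.
case=> _ w1 wP k.
pose u j := w j / dR j.
have wu j : w j = dR j * u j by rewrite /u mulrC divfK.
have uc l : u l = u k.
  apply: harmonic_const => {}l; rewrite lapE -/(dR l) -wu -{1}(wP l).
  apply/eqP; rewrite subr_eq0; apply/eqP; apply: eq_bigr => j _.
  by rewrite /trans /u e_sym -/(dR j); ring.
have -> : \sum_j dR j = (\sum_j w j) / u k.
  rewrite mulr_suml; apply: eq_bigr => j _; rewrite wu uc mulfK //.
  apply/eqP => u0; move: w1; rewrite big1 => [/eqP|l _]; last by rewrite wu uc u0 mulr0.
  by rewrite eq_sym oner_eq0.
by rewrite w1 div1r invrK wu.
Qed.

Lemma transE (g : V -> R) j : \sum_l trans R e j l * g l = g j - lap g j / dR j.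
Proof.
rewrite lapE -/(dR j) mulrBl mulrAC divff // mul1r opprB addrC subrK mulr_suml.
by apply: eq_bigr => l _; rewrite /trans -/(dR j) mulrAC.
Qed.

Lemma trans_ge0 j l : 0 <= trans R e j l.
Proof. by rewrite divr_ge0 ?ler0n. Qed.

Lemma sum_trans j : \sum_l trans R e j l = 1.
Proof.
have := transE (fun=> 1) j; under eq_bigr do rewrite mulr1.
by move=> ->; rewrite /lap big1 ?mul0r ?subr0 // => l _; rewrite subrr mulr0.
Qed.

#[local] Arguments first_hit : simpl never.

(** * First passage times as limits of truncated expectations *)

Section Hitting.
Variable k : V.

Lemma transE_off (g : V -> R) j : g k = 0 ->
  \sum_(l | l != k) trans R e j l * g l = g j - lap g j / dR j.
Proof. by move=> gk; rewrite -transE [RHS](bigD1 k) //= gk mulr0 add0r. Qed.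

Local Notation f := (first_hit R e k).

Lemma first_hitS t j :
  f t.+2 j = \sum_(l | l != k) trans R e j l * f t.+1 l.
Proof. by []. Qed.

Lemma first_hit_ge0 t j : 0 <= f t j.
Proof.
elim: t j => [|[|t] IH] j //; first exact: trans_ge0.
by rewrite first_hitS sumr_ge0 // => l _; rewrite mulr_ge0 ?trans_ge0 ?IH.
Qed.

(** [F n j] is the probability that the walk from [j] visits [k] within [n] steps; [A n j] is the
    part of the expected first passage time that comes from those times. *)
Let F n j : R := \sum_(1 <= t < n.+1) f t j.
Let A n j : R := \sum_(1 <= t < n.+1) t%:R * f t j.

Let F0 j : F 0 j = 0. Proof. by rewrite /F big_geq. Qed.
Let A0 j : A 0 j = 0. Proof. by rewrite /A big_geq. Qed.

Let FS n j : F n.+1 j = trans R e j k + \sum_(l | l != k) trans R e j l * F n l.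
Proof.
rewrite /F big_ltn //; congr (_ + _).
rewrite big_add1 /=; under [RHS]eq_bigr do rewrite mulr_sumr.
rewrite [RHS]exchange_big /=; apply: eq_big_nat => t /andP[t1 _].
by case: t t1.
Qed.

(** Write each time after the first step as t + 1: the ones add up to [F n.+1 j], and the t-parts
    recombine after one step of the walk. *)
Let AS n j : A n.+1 j = F n.+1 j + \sum_(l | l != k) trans R e j l * A n l.
Proof.
rewrite /F /A [in RHS]big_ltn // [in LHS]big_ltn // mul1r -addrA.
congr (_ + _); under [X in _ = _ + X]eq_bigr do rewrite mulr_sumr.
rewrite [X in _ = _ + X]exchange_big [LHS]big_add1 [X in _ = X + _]big_add1 -big_split /=; apply: eq_big_nat => t /andP[t1 _].
case: t t1 => // t _; rewrite first_hitS mulr_sumr -big_split /=.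
by apply: eq_bigr => l _; rewrite -[t.+2%:R]natr1; ring.
Qed.

Let F_le1 n j : F n j <= 1.
Proof.
elim: n j => [|n IH] j; first by rewrite F0.
rewrite FS -(sum_trans j) [leRHS](bigD1 k) //= lerD2l ler_sum // => l _.
by rewrite ler_piMr ?trans_ge0.
Qed.

Let F_ndec j : nondecreasing_seq (F^~ j).
Proof.
apply/nondecreasing_seqP => n; rewrite /F [leRHS]big_nat_recr //= lerDl.
exact: first_hit_ge0.
Qed.

Let A_ndec j : nondecreasing_seq (A^~ j).
Proof.
apply/nondecreasing_seqP => n; rewrite /A [leRHS]big_nat_recr //= lerDl.
by rewrite mulr_ge0 ?first_hit_ge0.
Qed.

Let lim_eq (u v : nat -> R) (a b : R) : (u n @[n --> \oo] --> a)%classic ->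
  (v n @[n --> \oo] --> b)%classic -> (forall n, u n = v n) -> a = b.
Proof.
move=> ua vb /funext uv; apply: (@cvg_unique _ _ (u n @[n --> \oo])%classic) => //.
by rewrite uv.
Qed.

Let cvg_trans (B : nat -> V -> R) (b : V -> R) (j : V) :
  (forall l, l != k -> (B n l @[n --> \oo] --> b l)%classic) ->
  ((\sum_(l | l != k) trans R e j l * B n l) @[n --> \oo] -->
    \sum_(l | l != k) trans R e j l * b l)%classic.
Proof.
move=> Bb; apply: cvg_big; first exact: add_continuous.
by move=> l lk; apply: cvgMl_tmp; exact: Bb.
Qed.

(** The walk reaches [k] almost surely: the monotone limit of [F] solves the first-step equation,
    and so does the constant 1. *)
Let F_cvg j : j != k -> (F n j @[n --> \oo] --> (1 : R))%classic.
Proof.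
have cF l : (F n l @[n --> \oo] --> limn (F^~ l))%classic.
  apply: nondecreasing_is_cvgn; first exact: F_ndec.
  by exists 1 => _ [n _ <-]; exact: F_le1.
pose b l := limn (F^~ l).
have bE l : b l = trans R e l k + \sum_(i | i != k) trans R e l i * b i.
  apply: (lim_eq _ _ (FS^~ l)); first by have := cF l; rewrite -(cvg_shiftS (F^~ l)).
  by apply: cvgD; [exact: cvg_cst | apply: cvg_trans => i _; exact: cF].
(* The value at [k] is reset to 0, because [b k] is a return probability and not a boundary
   value. *)
pose u l : R := (l != k)%:R * (1 - b l).
have u0 : forall l, u l = 0.
  have uk : u k = 0 by rewrite /u eqxx mul0r.
  apply: (@harmonic_off_eq0 _ k) => // l lk.
  have := transE_off l uk.
  have -> : \sum_(i | i != k) trans R e l i * u i = u l.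
    have := sum_trans l; rewrite (bigD1 k) //= => s1.
    rewrite {2}/u lk mul1r bE -[in RHS]s1 opprD addrACA subrr add0r -sumrB.
    by apply: eq_bigr => i ik; rewrite /u ik mul1r mulrBr mulr1.
  move/eqP; rewrite -subr_eq0 opprB addrC subrK mulf_eq0 invr_eq0.
  by rewrite (negbTE (dR_neq0 l)) orbF => /eqP.
move=> jk; move: (u0 j); rewrite /u jk mul1r => /eqP.
by rewrite subr_eq0 => /eqP ->; exact: cF.
Qed.

(** Any solution [h] of the first-step equation bounds the truncated expectations, so these
    converge; their limit solves the same equation and equals [h] by uniqueness. *)
Lemma mfpt_hitting (h : V -> R) : h k = 0 ->
  (forall j, j != k -> lap h j = dR j) -> forall j, j != k -> mfpt R e j k = h j.
Proof.
move=> hk hL.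
have hE j : j != k -> h j = 1 + \sum_(l | l != k) trans R e j l * h l.
  by move=> jk; rewrite transE_off // hL // divff // addrC subrK.
(* Minimum principle: at a minimiser [i] other than [k] the mean of [h] after one step is [h i - 1],
   which is below the minimum. *)
have h_ge0 j : 0 <= h j.
  case: (arg_minP h (erefl : xpredT k)) => i _ hmin.
  apply: le_trans (hmin j isT); have [->|ik] := eqVneq i k; first by rewrite hk.
  exfalso; have : h i * \sum_l trans R e i l <= \sum_l trans R e i l * h l.
    rewrite mulr_sumr ler_sum // => l _.
    by rewrite mulrC ler_wpM2l ?trans_ge0 ?hmin.
  by rewrite sum_trans mulr1 transE hL // divff // lerDl oppr_ge0 ler10.
have A_le n j : j != k -> A n j <= h j.
  elim: n j => [|n IH] j jk; first by rewrite A0.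
  rewrite AS hE // lerD ?F_le1 // ler_sum // => l lk.
  by rewrite ler_wpM2l ?trans_ge0 ?IH.
pose b j := (j != k)%:R * limn (A^~ j).
have cA j : j != k -> (A n j @[n --> \oo] --> b j)%classic.
  move=> jk; rewrite /b jk mul1r; apply: nondecreasing_is_cvgn; first exact: A_ndec.
  by exists (h j) => _ [n _ <-]; exact: A_le.
have bE j : j != k -> b j = 1 + \sum_(l | l != k) trans R e j l * b l.
  move=> jk; apply: (lim_eq _ _ (AS^~ j)).
    by have := cA j jk; rewrite -(cvg_shiftS (A^~ j)).
  apply: cvgD; last by apply: cvg_trans => l lk; exact: cA.
  by have := F_cvg jk; rewrite -(cvg_shiftS (F^~ j)).
have bk : b k = 0 by rewrite /b eqxx mul0r.
have u0 : forall l, h l - b l = 0.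
  apply: (@harmonic_off_eq0 _ k) => [l lk|]; last by rewrite hk bk subrr.
  have := @transE_off (fun i => h i - b i) l.
  rewrite hk bk subrr => /(_ erefl).
  have -> : \sum_(i | i != k) trans R e l i * (h i - b i) = h l - b l.
    rewrite hE // bE // opprD addrACA subrr add0r -sumrB.
    by apply: eq_bigr => i ik; ring.
  move/eqP; rewrite -subr_eq0 opprB addrC subrK mulf_eq0 invr_eq0.
  by rewrite (negbTE (dR_neq0 l)) orbF => /eqP.
move=> j jk; move/eqP: (u0 j); rewrite subr_eq0 => /eqP ->.
(* The partial sums of the series stop before [n], while [A n] includes the term at [n]; hence the
   shift. *)
apply: cvg_lim => //; rewrite -(cvg_shiftS (fun n => \sum_(1 <= t < n) t%:R * f t j)).
exact: cA.
Qed.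

End Hitting.

Lemma kemenyE w j : stationary e w ->
  kemeny e w j = (\sum_k \sum_z dR k * dR z * r k z) / (2 * \sum_k dR k).
Proof.
move=> w_stat.
pose D := \sum_i dR i.
have D0 : D != 0 by rewrite gt_eqF ?(sum_deg_gt0 j).
(* The candidate hitting time: away from [k] the [tau] terms of the two columns cancel, and the
   remaining delta at [z = i] yields [dR i]. *)
pose h k i : R := (\sum_z dR z * (r i k + r k z - r i z)) / 2.
have hk k : h k k = 0.
  rewrite /h big1 ?mul0r // => z _; rewrite r_res.1 //; ring.
have hL k i : i != k -> lap (h k) i = dR i.
  move=> ik.
  have -> : lap (h k) i = (\sum_z dR z * (lap (r^~ k) i - lap (r^~ z) i)) / 2.
    rewrite /lap; under [in RHS]eq_bigr do rewrite -sumrB mulr_sumr.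
    rewrite exchange_big mulr_suml /=; apply: eq_bigr => l _.
    by rewrite /h -mulrBl -sumrB mulrA mulr_sumr; congr (_ / _); apply: eq_bigr => z _; ring.
  under eq_bigr do rewrite !r_res.2 (negbTE ik) mulr0 subr0.
  by rewrite -(sum_indl i dR) mulr_suml; apply: eq_bigr => z _; field.
have -> : kemeny e w j = \sum_k h k j * w k.
  rewrite /kemeny [RHS](bigD1 j) //= hk mul0r add0r; apply: eq_bigr => k kj.
  rewrite (@mfpt_hitting k (h k)) // 1?eq_sym //; exact: hL.
have -> : \sum_k h k j * w k =
    (\sum_k \sum_z dR k * dR z * (r j k + r k z - r j z)) / (2 * D).
  rewrite mulr_suml; apply: eq_bigr => k _; rewrite (stationaryE w_stat) -/D /h.
  rewrite !mulr_suml; apply: eq_bigr => z _; field.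
  by rewrite D0.
congr (_ / _).
(* The two terms that involve [j] cancel on exchanging [k] and [z], so the value is independent of
   the starting vertex. *)
have -> : \sum_k \sum_z dR k * dR z * (r j k + r k z - r j z) =
  \sum_k \sum_z dR k * dR z * r k z + (\sum_k \sum_z dR k * dR z * r j k
     - \sum_k \sum_z dR k * dR z * r j z).
  rewrite -sumrB -big_split /=; apply: eq_bigr => k _.
  by rewrite -sumrB -big_split /=; apply: eq_bigr => z _; ring.
rewrite [X in _ + (X - _)]exchange_big /=.
rewrite [X in _ + X](_ : _ = 0) ?addr0 //; apply/eqP; rewrite subr_eq0; apply/eqP.
by apply: eq_bigr => k _; apply: eq_bigr => z _; ring.
Qed.

End Resistance.
End Laplacian.

(** * Adding an edge: update of the Laplacian and of the resistance function *)

Section AddEdge.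
Variables (R : realType) (V : finType) (e : rel V) (a b : V).
Hypotheses (e_sym : symmetric e) (ab_neq : a != b) (nab : ~~ e a b).

Lemma add_edge_sym : symmetric (add_edge e a b).
Proof.
move=> x y; rewrite /add_edge /= e_sym -!orbA; congr (_ || _).
by rewrite orbC andbC; congr (_ || _); rewrite andbC.
Qed.

Lemma add_edgeE x y : (add_edge e a b x y)%:R =
  (e x y)%:R + ((x == a)%:R * (y == b)%:R + (x == b)%:R * (y == a)%:R) :> R.
Proof.
rewrite /add_edge /= -!natrM !mulnb -!natrD.
have eA : ~~ (e x y && ((x == a) && (y == b))).
  by apply/negP => /and3P[exy /eqP xa /eqP yb]; rewrite xa yb (negbTE nab) in exy.
have eB : ~~ (e x y && ((x == b) && (y == a))).
  by apply/negP => /and3P[exy /eqP xb /eqP ya]; rewrite xb ya e_sym (negbTE nab) in exy.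
have AB : ~~ (((x == a) && (y == b)) && ((x == b) && (y == a))).
  by apply/negP => /andP[/andP[/eqP -> _] /andP[ab0 _]]; move: ab_neq; rewrite ab0.
by move: eA eB AB; case: (e x y); case: ((x == a) && _); case: ((x == b) && _).
Qed.

Lemma deg_add_edge x :
  (deg (add_edge e a b) x)%:R = (deg e x)%:R + (x == a)%:R + (x == b)%:R :> R.
Proof.
rewrite !degE; under eq_bigr do rewrite add_edgeE.
by rewrite big_split big_split /= -!mulr_sumr !sum_ind1 !mulr1 addrA.
Qed.

Lemma lap_add_edge (g : V -> R) j : lap (add_edge e a b) g j =
  lap e g j + ((j == a)%:R - (j == b)%:R) * (g a - g b).
Proof.
rewrite /lap; under eq_bigr do rewrite add_edgeE mulrDl mulrDl -!mulrA.
rewrite big_split big_split /= -!mulr_sumr !sum_indr; congr (_ + _).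
have [->|_] := eqVneq j a; first by rewrite (negbTE ab_neq) /=; ring.
by have [->|_] := eqVneq j b; rewrite /=; ring.
Qed.

Variables (r : V -> V -> R) (tau : V -> R).
Hypotheses (r_sym : forall x y, r x y = r y x) (r_res : resistance e r tau).
Hypothesis c_neq0 : 1 + r a b != 0.

Definition potential x := r x a - r x b.

Let phi := potential.

(** A rank-one update. In the expanded square, the term in [phi x ^+ 2] changes only [tau], the term
    in [phi k ^+ 2] is constant in [x], and the cross term, whose Laplacian is supported on [a] and
    [b], cancels the contribution of the new edge. *)
Lemma add_edge_resistance :
  resistance (add_edge e a b)
    (fun x y => r x y - (phi x - phi y) ^+ 2 / (4 * (1 + r a b)))
    (fun j => tau j - lap e (fun x => phi x ^+ 2) j / (4 * (1 + r a b))).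
Proof.
split=> [k|j k]; first by rewrite r_res.1 subrr expr0n mul0r subr0.
rewrite lap_add_edge.
have -> : lap e (fun x => r x k - (phi x - phi k) ^+ 2 / (4 * (1 + r a b))) j =
    lap e (r^~ k) j - (lap e (fun x => phi x ^+ 2) j
      - 2 * phi k * (lap e (r^~ a) j - lap e (r^~ b) j)) / (4 * (1 + r a b)).
  rewrite /lap -sumrB mulr_sumr -sumrB mulr_suml -sumrB; apply: eq_bigr => l _.
  by rewrite /phi /potential; ring.
rewrite !r_res.2 /phi /potential !r_res.1 (r_sym k a) (r_sym k b) (r_sym b a).
by field.
Qed.

End AddEdge.

(** * Counting common lower bounds of triples in a finite order *)

Section OrderTriples.
Variables (R : realType) (V : finType) (O : pred V) (le : rel V).
Hypotheses (le_refl : reflexive le) (le_anti : forall x y, le x y -> le y x -> x = y).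
Hypothesis le_trans : transitive le.

(** [D z ^+ 2 - D z] counts ordered pairs of distinct elements of [O] above [z], so [T] is the
    number M of triples in the overview. *)
Let k : R := \sum_(x | O x) 1.
Let D z : R := \sum_(x | O x) (le z x)%:R.
Let A : R := \sum_(x | O x) \sum_(y | O y) (le x y)%:R.
Let T : R := \sum_(z | O z) (D z ^+ 2 - D z).

Let sum_indO x (F : V -> R) : O x -> \sum_(y | O y) (x == y)%:R * F y = F x.
Proof.
move=> Ox; rewrite (bigD1 x) //= eqxx mul1r big1 ?addr0 // => y /andP[_ /negbTE yx].
by rewrite eq_sym yx mul0r.
Qed.

(** The indicator of incomparability; the Kronecker term repairs the diagonal, where both order
    relations hold. *)
Let gap x y : R := 1 + (x == y)%:R - (le x y)%:R - (le y x)%:R.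

Let gap_ge0 x y : 0 <= gap x y.
Proof.
rewrite /gap; have [->|xy] := eqVneq x y; first by rewrite le_refl /=; lra.
have : ~~ (le x y && le y x) by apply: contraNN xy => /andP[? ?]; apply/eqP/le_anti.
by case: (le x y); case: (le y x) => //= _; lra.
Qed.

Let gap_eq0 x y : (gap x y == 0) = le x y || le y x.
Proof.
rewrite /gap; have [->|xy] := eqVneq x y; first by rewrite le_refl addrK subrr eqxx.
have : ~~ (le x y && le y x) by apply: contraNN xy => /andP[? ?]; apply/eqP/le_anti.
by case: (le x y); case: (le y x) => //= _; rewrite !(addr0, subr0, subrr) ?eqxx ?oner_eq0.
Qed.

Let sum_gap : \sum_(x | O x) \sum_(y | O y) gap x y = k ^+ 2 + k - 2 * A.
Proof.
have -> : k ^+ 2 + k - 2 * A = \sum_(x | O x) \sum_(y | O y) (1 : R)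
    + \sum_(x | O x) \sum_(y | O y) (x == y)%:R * 1
    - A - \sum_(x | O x) \sum_(y | O y) (le y x)%:R.
  rewrite [X in _ = _ - X]exchange_big /= -/A.
  have -> : \sum_(x | O x) \sum_(y | O y) (x == y)%:R * 1 = k.
    by apply: eq_bigr => x Ox; rewrite sum_indO.
  have -> : \sum_(x | O x) \sum_(y | O y) (1 : R) = k ^+ 2.
    by rewrite expr2 {1}/k mulr_suml; apply: eq_bigr => x _; rewrite mul1r.
  by ring.
rewrite -big_split -!sumrB; apply: eq_bigr => x _ /=.
by rewrite -big_split -!sumrB; apply: eq_bigr => y _; rewrite /gap mulr1.
Qed.

(* For distinct [x], [y], [z] at most one of the three lies below the two others;
   [slack] adds the corrections needed on the diagonals. *)
Let tri x y z : R :=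
  (le z x)%:R * (le z y)%:R + (le x y)%:R * (le x z)%:R + (le y z)%:R * (le y x)%:R.

Let diag x y z : R := (x == y)%:R * ((le z x)%:R + 2 * (le x z)%:R - 1).

Let slack x y z : R :=
  1 + diag x y z + diag y z x + diag z x y - 4 * ((x == y)%:R * (y == z)%:R) - tri x y z.

Let slackP x y z :
  0 <= slack x y z /\ (le x y || le y x -> le y z || le z y -> le z x || le x z -> slack x y z = 0).
Proof.
rewrite /slack /diag /tri.
have [<-|xy] := eqVneq x y.
  have [<-|xz] := eqVneq x z; first by rewrite le_refl /=; split => [|_ _ _]; lra.
  by rewrite le_refl /=; case: (le x z); case: (le z x); split=> /=; lra.
have [<-|yz] := eqVneq y z.
  by rewrite [y == x]eq_sym (negbTE xy) le_refl /=; case: (le x y); case: (le y x); split=> /=; lra.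
have [->|zx] := eqVneq z x.
  by rewrite le_refl /=; case: (le x y); case: (le y x); split=> /=; lra.
have a1 : ~~ (le x y && le y x) by apply: contraNN xy => /andP[? ?]; apply/eqP/le_anti.
have a2 : ~~ (le y z && le z y) by apply: contraNN yz => /andP[? ?]; apply/eqP/le_anti.
have a3 : ~~ (le z x && le x z) by apply: contraNN zx => /andP[? ?]; apply/eqP/le_anti.
(* All six instances of transitivity are collected, so that the Boolean case analysis can discard
   the inconsistent orderings. *)
have t1 : le x y -> le y z -> le x z by exact: le_trans.
have t2 : le y z -> le z x -> le y x by exact: le_trans.
have t3 : le z x -> le x y -> le z y by exact: le_trans.
have t4 : le x z -> le z y -> le x y by exact: le_trans.
have t5 : le z y -> le y x -> le z x by exact: le_trans.
have t6 : le y x -> le x z -> le y z by exact: le_trans.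
move: a1 a2 a3 t1 t2 t3 t4 t5 t6.
case: (le x y); case: (le y x) => //; case: (le y z); case: (le z y) => //;
case: (le z x); case: (le x z) => //= _ _ _;
do 6 (move=> h; first [by move: (h isT isT) | clear h]);
by split=> //=; lra.
Qed.

Let sum_diag : \sum_(x | O x) \sum_(y | O y) \sum_(z | O z) diag x y z = 3 * A - k ^+ 2.
Proof.
have -> : 3 * A - k ^+ 2 =
    \sum_(x | O x) \sum_(z | O z) ((le z x)%:R + 2 * (le x z)%:R - 1).
  have -> : 3 * A - k ^+ 2 = \sum_(x | O x) \sum_(z | O z) (le z x)%:R
      + 2 * A - \sum_(x | O x) \sum_(z | O z) 1.
    rewrite [X in _ = X + _ - _]exchange_big /= -/A.
    have -> : \sum_(x | O x) \sum_(y | O y) (1 : R) = k ^+ 2.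
      by rewrite expr2 {1}/k mulr_suml; apply: eq_bigr => x _; rewrite mul1r.
    by ring.
  rewrite mulr_sumr -big_split -sumrB; apply: eq_bigr => x _ /=.
  by rewrite mulr_sumr -big_split -sumrB.
apply: eq_bigr => x Ox; rewrite exchange_big /=; apply: eq_bigr => z Oz.
exact: (sum_indO (fun=> _)).
Qed.

Let rot3 (F : V -> V -> V -> R) :
  \sum_(x | O x) \sum_(y | O y) \sum_(z | O z) F y z x =
  \sum_(x | O x) \sum_(y | O y) \sum_(z | O z) F x y z.
Proof. by rewrite exchange_big /=; apply: eq_bigr => x _; rewrite exchange_big. Qed.

Let sum_slack : \sum_(x | O x) \sum_(y | O y) \sum_(z | O z) slack x y z =
  k ^+ 3 - k - 3 * T - 3 * (k ^+ 2 + k - 2 * A).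
Proof.
pose S3 F : R := \sum_(x | O x) \sum_(y | O y) \sum_(z | O z) F x y z.
pose below x y z : R := (le x y)%:R * (le x z)%:R.
have SB F G : S3 (fun x y z => F x y z - G x y z) = S3 F - S3 G.
  by rewrite /S3 -sumrB; apply: eq_bigr => x _; rewrite -sumrB; apply: eq_bigr => y _; rewrite -sumrB.
have SD F G : S3 (fun x y z => F x y z + G x y z) = S3 F + S3 G.
  by rewrite /S3 -big_split; apply: eq_bigr => x _; rewrite -big_split; apply: eq_bigr => y _; rewrite -big_split.
have S1 : S3 (fun _ _ _ => 1) = k ^+ 3.
  rewrite exprS expr2 {1}/k mulr_suml; apply: eq_bigr => x _; rewrite mul1r.
  by rewrite {1}/k mulr_suml; apply: eq_bigr => y _; rewrite mul1r.
have Sdiag3 : S3 (fun x y z => 4 * ((x == y)%:R * (y == z)%:R)) = 4 * k.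
  rewrite mulr_sumr; apply: eq_bigr => x Ox.
  rewrite mulr1 -[RHS](@sum_indO x (fun=> 4)) //; apply: eq_bigr => y Oy.
  rewrite -[RHS](@sum_indO y (fun=> (x == y)%:R * 4)) //.
  by apply: eq_bigr => z _; ring.
have Sbelow : S3 below = T + A.
  rewrite /T /A -big_split /=; apply: eq_bigr => z _.
  rewrite -[X in _ + X]/(D z) subrK expr2 {1}/D mulr_suml; apply: eq_bigr => x _.
  by rewrite mulr_sumr.
have Stri : S3 tri = 3 * (T + A).
  have -> : S3 tri = S3 (fun x y z => below z x y) + S3 below + S3 (fun x y z => below y z x).
    by rewrite -!SD.
  rewrite /S3 (rot3 below) -(rot3 (fun x y z => below z x y)) -/(S3 _) -/(S3 below).
  by rewrite Sbelow; ring.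
have -> : \sum_(x | O x) \sum_(y | O y) \sum_(z | O z) slack x y z =
  S3 (fun _ _ _ => 1) + S3 diag + S3 (fun x y z => diag y z x) + S3 (fun x y z => diag z x y)
   - S3 (fun x y z => 4 * ((x == y)%:R * (y == z)%:R)) - S3 tri.
  by rewrite -!SD -!SB.
rewrite S1 Sdiag3 Stri.
rewrite {2}/S3 (rot3 diag) {2}/S3 -(rot3 (fun x y z => diag z x y)) /S3 !sum_diag.
by ring.
Qed.

(** By [sum_slack] and [sum_gap], [k ^+ 3 - k - 3 * T] is the sum of all [slack] plus three times
    the sum of all [gap]. Both are nonnegative; the second vanishes only when all pairs are
    comparable, and then the first vanishes as well. *)
Lemma chain_triples :
  T <= (k ^+ 3 - k) / 3 /\
  (T = (k ^+ 3 - k) / 3 <-> forall x y, O x -> O y -> le x y || le y x).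
Proof.
have slack_ge0 : 0 <= \sum_(x | O x) \sum_(y | O y) \sum_(z | O z) slack x y z.
  by apply: sumr_ge0 => x _; apply: sumr_ge0 => y _; apply: sumr_ge0 => z _; exact: (slackP x y z).1.
have gapS_ge0 : 0 <= \sum_(x | O x) \sum_(y | O y) gap x y.
  by apply: sumr_ge0 => x _; apply: sumr_ge0 => y _; exact: gap_ge0.
move: (sum_slack) (sum_gap) => sS sG.
split; first by lra.
split=> [TE x y Ox Oy|total].
  have /eqP : \sum_(x | O x) \sum_(y | O y) gap x y = 0 by lra.
  rewrite psumr_eq0 => [/allP/(_ x (mem_index_enum _))/implyP/(_ Ox)|i _]; last first.
    by apply: sumr_ge0 => ? _; exact: gap_ge0.
  rewrite psumr_eq0 => [/allP/(_ y (mem_index_enum _))/implyP/(_ Oy)|i _]; last exact: gap_ge0.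
  by rewrite gap_eq0.
have s0 : \sum_(x | O x) \sum_(y | O y) \sum_(z | O z) slack x y z = 0.
  apply: big1 => x Ox; apply: big1 => y Oy; apply: big1 => z Oz.
  by apply: (slackP x y z).2; apply: total.
have g0 : \sum_(x | O x) \sum_(y | O y) gap x y = 0.
  apply: big1 => x Ox; apply: big1 => y Oy.
  by apply/eqP; rewrite gap_eq0 total.
by lra.
Qed.

End OrderTriples.

(** * Edges along a path *)

Section PathEdge.
Variable V : finType.
Implicit Types (s : seq V) (x y v : V).

Lemma path_edgeP d s x y : reflect
  (exists2 i, (i.+1 < size s)%N &
    (x = nth d s i /\ y = nth d s i.+1) \/ (y = nth d s i /\ x = nth d s i.+1))
  (path_edge s x y).
Proof.
have nthE i z : (i < size s)%N -> nth z s i = nth d s i by move=> si; exact: set_nth_default.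
have nthS i : (i.+1 < size s)%N -> (nth d s i = nth x s i) * (nth d s i.+1 = nth x s i.+1).
  by move=> si; rewrite !nthE // ltnW.
apply: (iffP hasP) => [[i _]|[i si xy]].
  by case/orP=> /and3P[/eqP E1 /eqP E2 si]; exists i => //; rewrite !(nthS i si) E1 E2; [left|right].
exists i; first by rewrite mem_iota leq0n add0n; exact: ltnW.
by move: xy; rewrite !(nthS i si) => -[[<- <-]|[<- <-]]; rewrite !eqxx si /= ?orbT.
Qed.

Lemma path_edge_sym s x y : path_edge s x y = path_edge s y x.
Proof.
by apply/(path_edgeP x)/(path_edgeP x) => -[i si H]; exists i => //; case: H; [right | left | right | left].
Qed.

Lemma path_edge_last v s t x : path_edge (v :: s ++ x :: t) x (last v s).
Proof.
apply/(path_edgeP v); exists (size s); first by rewrite /= size_cat /= addnS ltnS leq_addr.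
right; split; last by rewrite /= nth_cat ltnn subnn.
by rewrite -cat_cons nth_cat /= ltnSn -[LHS](nth_last v (v :: s)).
Qed.

Lemma path_edge_sub (e : rel V) v s x y : symmetric e -> path e v s ->
  path_edge (v :: s) x y -> e x y.
Proof.
move=> e_sym /(pathP v) ps /(path_edgeP v)[i si [[-> ->]|[-> ->]]]; first exact: ps.
by rewrite e_sym; exact: ps.
Qed.

Lemma path_edge_path (e : rel V) v s :
  (forall x y, path_edge (v :: s) x y -> e x y) -> path e v s.
Proof.
move=> h; apply/(pathP v) => i si; apply: h; apply/(path_edgeP v).
by exists i => //; left.
Qed.

End PathEdge.

(** Treats both parities in one polynomial formula; the correction [(~~ odd c)%:R] becomes the
    argument of [excess] below. *)
Lemma half_mul_half (R : realType) (c : nat) :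
  (c.+1./2)%:R * (c.+2./2)%:R = ((c%:R + 1) ^+ 2 - (~~ odd c)%:R) / 4 :> R.
Proof.
have [oc|oc] := boolP (odd c).
  have [E1 E2 E3] : [/\ c.+1./2 = c./2.+1, c.+2./2 = c./2.+1 & c = (2 * c./2).+1] by split; lia.
  by rewrite E1 E2 [in RHS]E3 -!natr1 natrM /=; field.
have [E1 E2 E3] : [/\ c.+1./2 = c./2, c.+2./2 = c./2.+1 & c = (2 * c./2)%N] by split; lia.
by rewrite E1 E2 [in RHS]E3 -natr1 natrM /=; field.
Qed.

(** * The tree rooted at one end of the path *)

Section RootedTree.
Variables (V : finType) (e : rel V).
Hypotheses (e_sym : symmetric e) (e_irr : irreflexive e) (e_tree : is_tree e).
Variable a : V.

(** Fixing the length by a tuple keeps the predicate Boolean, so that a least length can be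
    extracted as [depth]. *)
Definition reach n x := [exists s : n.-tuple V, path e a s && (last a s == x)].

Lemma reachP n x : reflect (exists s, [/\ path e a s, last a s = x & size s = n]) (reach n x).
Proof.
apply: (iffP existsP) => [[s /andP[ps /eqP sx]]|[s [ps sx /eqP sn]]].
  by exists s; rewrite size_tuple.
by exists (Tuple sn); rewrite /= ps sx eqxx.
Qed.

Lemma reachable x : exists n, reach n x.
Proof.
have /connectP[s ps xE] := e_tree.1 a x.
by exists (size s); apply/reachP; exists s.
Qed.

Definition depth x := ex_minn (reachable x).

Lemma closer_neighbor x : x != a -> exists y, e x y && (depth y < depth x)%N.
Proof.
move=> xa; rewrite {2}/depth; case: ex_minnP => n /reachP[s [ps sx sn]] _.
elim/last_ind: s ps sx sn => [_ xE _|s y _]; first by rewrite -xE eqxx in xa.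
rewrite rcons_path last_rcons size_rcons => /andP[ps sy] yx sn; subst y.
exists (last a s); rewrite e_sym sy -sn ltnS /= /depth.
by case: ex_minnP => m _; apply; apply/reachP; exists s.
Qed.

(** The root is its own parent, which makes [par] total and lets [anc] be connectivity along its
    graph. *)
Definition par x :=
  if x == a then a else odflt a [pick y | e x y && (depth y < depth x)%N].

Lemma par_root : par a = a. Proof. by rewrite /par eqxx. Qed.

Lemma parP x : x != a -> e x (par x) /\ (depth (par x) < depth x)%N.
Proof.
move=> xa; rewrite /par (negbTE xa); case: pickP => [y /andP[]//|no].
by have [y] := closer_neighbor xa; rewrite no.
Qed.

Lemma par_ind (P : V -> Prop) :
  P a -> (forall x, x != a -> P (par x) -> P x) -> forall x, P x.
Proof.
move=> Pa IH x; have [n] := ubnP (depth x); elim: n x => // n IHn x.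
rewrite ltnS => dn; have [->//|xa] := eqVneq x a.
by apply: IH => //; apply: IHn; apply: leq_trans dn; case: (parP xa).
Qed.

(** Every edge of an acyclic graph is a bridge: a simple path from [x] to [y] avoiding the edge has
    at least three vertices and would close up to a cycle. *)
Lemma no_bypass x y : e x y ->
  ~~ connect [rel u v | e u v && ~~ ((u == x) && (v == y)) && ~~ ((u == y) && (v == x))] x y.
Proof.
move=> exy; apply/negP => /connectP[s ps yE].
case: (shortenP ps) yE => s' ps' us' _ yE.
case: s' ps' us' yE => [|z s'] ps' us' yE; first by rewrite yE e_irr in exy.
case: s' ps' us' yE => [|w s'] ps' us' yE.
  by move: yE ps' => /= ->; rewrite !eqxx /= andbF.
have := e_tree.2 (x :: z :: w :: s') us' isT.
rewrite /cycle rcons_path -yE e_sym exy andbT => /negP; apply.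
by apply: sub_path ps' => u v /=; case: (e u v).
Qed.

(** If an edge were not a parent link, both its ends would still reach the root along parent links
    that avoid it, and this would bypass the edge. *)
Lemma edge_par x y : e x y = (x != a) && (y == par x) || (y != a) && (x == par y).
Proof.
apply/idP/orP => [exy|[] /andP[na /eqP->]]; last first.
- by rewrite e_sym; case: (parP na).
- by case: (parP na).
apply/orP; apply: contraT => /norP[nx ny].
case/negP: (no_bypass exy).
set e' := rel_of_simpl _.
have e'_sym : symmetric e'.
  by move=> u v; rewrite /e' /= e_sym -!andbA; congr (_ && _); rewrite andbC
    [(v == x) && _]andbC [(v == y) && _]andbC.
have to_root z : connect e' z a.
  elim/par_ind: z => [|z za IH]; first exact: connect0.
  apply: connect_trans IH; apply: connect1; rewrite /e' /= (parP za).1 /=.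
  apply/andP; split; apply/negP => /andP[/eqP zx /eqP py]; subst z.
    by rewrite za py eqxx in nx.
  by rewrite za py eqxx in ny.
apply: connect_trans (to_root x) _.
by rewrite (sym_connect_sym e'_sym) to_root.
Qed.

(** The order [z <= x] of the overview: [z] lies on the path from the root to [x]. *)
Definition anc z x := connect (frel par) x z.

Lemma anc_refl x : anc x x. Proof. exact: connect0. Qed.

Lemma anc_trans y x z : anc x y -> anc y z -> anc x z.
Proof. by rewrite /anc => xy yz; apply: connect_trans yz xy. Qed.

Lemma ancE z x : anc z x = (z == x) || anc z (par x).
Proof.
apply/idP/orP => [/connectP[s]|[/eqP->|]]; last 2 first.
- exact: anc_refl.
- by apply: connect_trans; apply: connect1; rewrite /= eqxx.
case: s => [|y s] /=; first by move=> _ ->; left.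
by case/andP => /eqP <- ps ->; right; apply/connectP; exists s.
Qed.

Lemma anc_depth z x : anc z x -> z = x \/ (depth z < depth x)%N.
Proof.
elim/par_ind: x => [|x xa IH].
  case/connectP => s ps ->; left; elim: s ps => //= y s IH /andP[/eqP <-].
  by rewrite par_root => /IH.
rewrite ancE => /orP[/eqP|/IH[->|zx]]; [by left | by right; case: (parP xa) |].
by right; apply: ltn_trans zx (parP xa).2.
Qed.

Lemma anc_anti x y : anc x y -> anc y x -> x = y.
Proof.
by case/anc_depth => // xy /anc_depth[//|yx]; have := ltn_trans xy yx; rewrite ltnn.
Qed.

Lemma anc_rootE z : anc z a = (z == a).
Proof.
apply/idP/eqP => [/anc_depth[//|]|->]; last exact: anc_refl.
rewrite /depth; case: (ex_minnP (reachable a)) => n _ /(_ 0%N).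
have -> : reach 0 a by apply/reachP; exists [::].
by move=> /(_ isT); rewrite leqn0 => /eqP ->; rewrite ltn0.
Qed.

Lemma anc_root x : anc a x.
Proof.
elim/par_ind: x => [|x xa IH]; first exact: anc_refl.
by rewrite ancE IH orbT.
Qed.

Lemma anc_par x : x != a -> anc x (par x) = false.
Proof.
move=> xa; apply/negP => /anc_depth; have [_ d] := parP xa; case=> [E|].
  by rewrite -E ltnn in d.
by rewrite ltnNge ltnW.
Qed.

Lemma anc_total x y z : anc x z -> anc y z -> anc x y || anc y x.
Proof.
elim/par_ind: z => [|z za IH].
  by rewrite !anc_rootE => /eqP -> /eqP ->; rewrite anc_refl.
move=> xz yz; move: (xz) (yz); rewrite ancE => /orP[/eqP->|xp].
  by rewrite yz orbT.
by rewrite ancE => /orP[/eqP->|yp]; [rewrite xz | exact: IH].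
Qed.

(** Each step of a simple path from the root descends to a child: a step up would return to an
    ancestor, which the path has already visited. *)
Lemma anc_last s z : path e a s -> uniq (a :: s) -> anc z (last a s) = (z \in a :: s).
Proof.
elim/last_ind: s z => [|s y IH] z; first by rewrite anc_rootE inE.
rewrite rcons_path last_rcons => /andP[ps sy].
rewrite -rcons_cons rcons_uniq => /andP[ys us].
have ya : y != a by apply: contraNneq ys => ->; rewrite mem_head.
have -> : anc z y = (z == y) || anc z (last a s).
  move: sy; rewrite edge_par => /orP[|/andP[_ /eqP->]]; last exact: ancE.
  case/andP=> _ /eqP yp; case/negP: ys; rewrite -IH // yp.
  by rewrite ancE anc_refl orbT.
by rewrite IH // mem_rcons [RHS]inE.
Qed.

Lemma par_path p s t x y : path e a p -> uniq (a :: p) ->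
  a :: p = s ++ [:: x, y & t] -> par y = x.
Proof.
move=> pp up pE; case: s pE => [|a' s] [aE pE].
  by move: pp; rewrite pE -aE /= edge_par eqxx /= => /andP[/andP[_ /eqP<-] _].
move: pp up; rewrite pE -cat_rcons -cat_cons cat_uniq cat_path last_rcons.
move=> /andP[ps /andP[xy _]] /and3P[us /norP[ys _] _].
move: xy; rewrite edge_par => /orP[|/andP[_ /eqP->//]].
case/andP=> _ /eqP yx; case/negP: ys; rewrite -(anc_last _ ps us).
by rewrite last_rcons ancE yx anc_refl orbT.
Qed.

(** * The tree distance as a resistance function *)

Variable R : realType.

Local Notation "''a_' ( z , x )" := ((anc z x)%:R : R) (at level 8, format "''a_' ( z , x )").

(** The graph distance of the tree: each non-root [z] stands for the edge to its parent, and the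
    square is 1 exactly when this edge separates [x] from [y]. *)
Definition tdist (x y : V) : R := \sum_z ((anc z x)%:R - (anc z y)%:R) ^+ 2.

Lemma tdist_sym x y : tdist x y = tdist y x.
Proof. by apply: eq_bigr => z _; rewrite -opprB sqrrN. Qed.

Lemma tdistxx x : tdist x x = 0.
Proof. by rewrite /tdist big1 // => z _; rewrite subrr expr0n. Qed.

Lemma anc_par_neq z x : z != x -> anc z x = anc z (par x).
Proof. by move=> zx; rewrite ancE (negbTE zx). Qed.

Lemma tdist_par x k : x != a -> tdist x k - tdist (par x) k = 1 - 2 * 'a_(x, k).
Proof.
move=> xa; rewrite -sumrB (bigD1 x) //= big1 => [|z zx].
  by rewrite addr0 anc_refl anc_par //=; ring.
by rewrite (anc_par_neq zx) subrr.
Qed.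

Lemma tdist_root x : tdist x a = \sum_(z | z != a) 'a_(z, x).
Proof.
rewrite /tdist (bigD1 a) //= anc_root anc_refl subrr expr0n add0r.
by apply: eq_bigr => z za; rewrite anc_rootE (negbTE za) subr0; case: (anc z x); rewrite ?expr1n ?expr0n.
Qed.

Lemma edge_parE x y : (e x y)%:R =
  (x != a)%:R * (y == par x)%:R + (y != a)%:R * (x == par y)%:R :> R.
Proof.
rewrite -!natrM !mulnb -natrD edge_par; congr _%:R.
have : ~~ (((x != a) && (y == par x)) && ((y != a) && (x == par y))).
  apply/negP => /andP[/andP[xa /eqP yp] /andP[ya /eqP xp]].
  have dx := (parP xa).2; have dy := (parP ya).2; rewrite -yp in dx; rewrite -xp in dy.
  by have := ltn_trans dx dy; rewrite ltnn.
by case: (_ && (y == par x)); case: (_ && (x == par y)).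
Qed.

Lemma sum_edge x (G : V -> R) : \sum_y (e x y)%:R * G y =
  (x != a)%:R * G (par x) + \sum_(y | y != a) (x == par y)%:R * G y.
Proof.
under eq_bigr do rewrite edge_parE mulrDl -!mulrA.
rewrite big_split /= -mulr_sumr sum_indr; congr (_ + _).
rewrite [RHS]big_mkcond /=; apply: eq_bigr => y _.
by case: (y != a); rewrite /= ?mul1r ?mul0r.
Qed.

(** Passing from a vertex to its parent changes only one term of the distance ([tdist_par]), so the
    Laplacian at [j] reduces to counting the children of [j] that lie on the way to [k]. *)
Lemma tdist_resistance : resistance e tdist (fun j => 2 - (deg e j)%:R).
Proof.
split=> [k|j k]; first exact: tdistxx.
rewrite /lap sum_edge degE.
under [in RHS]eq_bigr do rewrite -[(e j _)%:R]mulr1; rewrite sum_edge.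
(* Exactly one child of [j] is an ancestor of [k] when [j] is a proper ancestor of [k], and none
   otherwise. *)
have children : \sum_(y | y != a) (j == par y)%:R * 'a_(y, k) = 'a_(j, k) - (j == k)%:R.
  elim/par_ind: k => [|k ka IH].
    rewrite big1 => [|y ya]; first by rewrite anc_rootE subrr.
    by rewrite anc_rootE (negbTE ya) mulr0.
  have -> : \sum_(y | y != a) (j == par y)%:R * 'a_(y, k) =
    \sum_(y | y != a) (y == k)%:R * (j == par k)%:R
    + \sum_(y | y != a) (j == par y)%:R * 'a_(y, par k).
    rewrite -big_split; apply: eq_bigr => y ya /=.
    have [->|yk] := eqVneq y k; last by rewrite (anc_par_neq yk) mul0r add0r.
    by rewrite anc_refl anc_par // mul1r mulr1 mulr0 addr0.
  rewrite IH [X in X + _](_ : _ = (j == par k)%:R); last first.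
    by rewrite (bigD1 k) //= eqxx mul1r big1 ?addr0 // => y /andP[_ /negbTE->]; rewrite mul0r.
  rewrite addrC subrK; have [->|jk] := eqVneq j k; last by rewrite (anc_par_neq jk) subr0.
  by rewrite anc_refl anc_par // subrr.
have -> : \sum_(y | y != a) (j == par y)%:R * (tdist j k - tdist y k) =
   2 * ('a_(j, k) - (j == k)%:R) - \sum_(y | y != a) (j == par y)%:R * 1.
  rewrite -children mulr_sumr -sumrB; apply: eq_bigr => y ya.
  have [->|_] := eqVneq j (par y); last by rewrite !mul0r mulr0 subr0.
  by have := tdist_par k ya; rewrite !mul1r; lra.
have [->|ja] := eqVneq j a; first by rewrite anc_root /=; ring.
by rewrite (tdist_par k ja) /=; ring.
Qed.

(** Double counting: the edges are the pairs ([x], [par x]) with [x] not the root, and each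
    contributes the values at its two ends. *)
Lemma sum_deg (g : V -> R) :
  \sum_x (deg e x)%:R * g x = \sum_(x | x != a) (g x + g (par x)).
Proof.
transitivity (\sum_x ((x != a)%:R * g x + \sum_(y | y != a) (x == par y)%:R * g x)).
  apply: eq_bigr => x _; rewrite degE.
  under eq_bigr do rewrite -[(e x _)%:R]mulr1; rewrite sum_edge mulrDl mulr1; congr (_ + _).
  by rewrite mulr_suml; apply: eq_bigr => y _; rewrite mulr1.
rewrite !big_split /=; congr (_ + _).
  by rewrite [RHS]big_mkcond; apply: eq_bigr => x _; case: (x != a); rewrite /= ?mul1r ?mul0r.
by rewrite exchange_big /=; apply: eq_bigr => y _; rewrite sum_indr.
Qed.

Lemma sum_nonroot (F : V -> R) : \sum_(x | x != a) F x = \sum_x F x - F a.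
Proof. by rewrite [in RHS](bigD1 a) //= addrAC subrr add0r. Qed.

Local Notation n := (#|V|%:R : R).

Lemma sum_one : \sum_(x : V) (1 : R) = n.
Proof. by rewrite sumr_const. Qed.

Lemma sum_deg1 : \sum_x (deg e x)%:R = 2 * (n - 1) :> R.
Proof.
have := sum_deg (fun=> 1); under eq_bigr do rewrite mulr1; move=> ->.
by rewrite (sum_nonroot (fun=> 1 + 1)) big_split /= sum_one; ring.
Qed.

Lemma sum_deg_tdist k :
  \sum_x (deg e x)%:R * tdist x k = 2 * (\sum_x tdist x k) - (n - 1).
Proof.
rewrite sum_deg.
have -> : \sum_(x | x != a) (tdist x k + tdist (par x) k) =
   2 * (\sum_(x | x != a) tdist x k) - \sum_(x | x != a) 1 + 2 * \sum_(x | x != a) 'a_(x, k).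
  rewrite !mulr_sumr -sumrB -big_split; apply: eq_bigr => x xa /=.
  by have := tdist_par k xa; lra.
by rewrite -tdist_root sum_nonroot (sum_nonroot (fun=> 1)) sum_one (tdist_sym k a); ring.
Qed.

(** * Levels, heights and distances relative to the path from [a] to [b] *)

Variable b : V.

Local Notation P x := (anc x b).
Local Notation c := (\sum_(z | P z) (1 : R)).

(** [level x] is the position, counted from 1, of the projection of [x] on the path; [height x] is
    the distance from [x] to the path. *)
Definition level x : R := \sum_(z | P z) 'a_(z, x).
Definition height x : R := \sum_(z | ~~ P z) 'a_(z, x).

Lemma sum_pathD1 (F : V -> R) :
  \sum_(x | P x) F x = F a + \sum_(x | (x != a) && P x) F x.
Proof.
by rewrite (bigD1 a) ?anc_root //=; congr (_ + _); apply: eq_bigl => x; rewrite andbC.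
Qed.

Lemma level_par x : x != a -> level x = level (par x) + 'a_(x, b).
Proof.
move=> xa; apply/eqP; rewrite addrC -subr_eq -sumrB; apply/eqP.
have [xb|xb] /= := boolP (anc x b); last first.
  rewrite big1 // => z zb; rewrite (@anc_par_neq z x) ?subrr //.
  by apply: contraNneq xb => <-.
rewrite (bigD1 x) //= anc_refl anc_par // subr0 big1 ?addr0 // => z /andP[_ zx].
by rewrite anc_par_neq // subrr.
Qed.

Lemma level_root : level a = 1.
Proof.
rewrite /level (bigD1 a) ?anc_root //= big1 ?addr0 // => z /andP[_ /negbTE za].
by rewrite anc_rootE za.
Qed.

Lemma level_end : level b = c.
Proof. by apply: eq_bigr => z ->. Qed.

Lemma telescope (g : V -> R) : \sum_(x | (x != a) && P x) (g x - g (par x)) = g b - g a.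
Proof.
elim/par_ind: b => [|y ya IH].
  by rewrite subrr big1 // => x; rewrite anc_rootE andNb.
rewrite (bigD1 y) /=; last by rewrite ya anc_refl.
rewrite (eq_bigl (fun x => (x != a) && anc x (par y))) ?IH; first by ring.
move=> x; have [->|xy] := eqVneq x y; first by rewrite anc_par // !andbF.
by rewrite anc_par_neq // andbT.
Qed.

(* A function that only varies along the path from [a] to [b] sees each branch
   of the tree with [deg] summing to twice the number of vertices, except for
   the two missing half-edges at the ends of the path. *)
Lemma sum_deg_level (g : V -> R) : (forall x, x != a -> ~~ P x -> g x = g (par x)) ->
  \sum_x (deg e x)%:R * g x = 2 * (\sum_x g x) - g a - g b.
Proof.
move=> gP; rewrite sum_deg.
have -> : \sum_(x | x != a) (g x + g (par x)) =
    2 * (\sum_(x | x != a) g x) - \sum_(x | x != a) (g x - g (par x)).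
  by rewrite mulr_sumr -sumrB; apply: eq_bigr => x _; ring.
have -> : \sum_(x | x != a) (g x - g (par x)) = g b - g a.
  rewrite -telescope [RHS]big_mkcondr; apply: eq_bigr => x xa /=.
  by case: ifPn => // /(gP _ xa) ->; rewrite subrr.
by rewrite sum_nonroot; ring.
Qed.

(** Off-path vertices contribute equally to both distances. The potential is thus affine in [level],
    with slope 2, which turns the correction of the resistance into
    [(level x - level y) ^+ 2 / c]. *)
Lemma tdist_diff x : tdist x a - tdist x b = 2 * level x - 1 - c.
Proof.
rewrite -sumrB (bigD1 a) //= !anc_root subrr add0r.
have -> : \sum_(z | z != a) (('a_(z, x) - 'a_(z, a)) ^+ 2 - ('a_(z, x) - 'a_(z, b)) ^+ 2)
  = \sum_(z | (z != a) && P z) (2 * 'a_(z, x) - 1).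
  rewrite [RHS]big_mkcondr; apply: eq_bigr => z za /=; rewrite anc_rootE (negbTE za).
  by case: (anc z b); case: (anc z x); rewrite /=; ring.
rewrite /level !sum_pathD1 anc_root sumrB -mulr_sumr /=; ring.
Qed.

Lemma tdist_sum x : tdist x a + tdist x b = 2 * height x + c - 1.
Proof.
rewrite -big_split (bigD1 a) //= !anc_root subrr expr0n !add0r.
rewrite (bigID (fun z => P z)) /=.
have -> : \sum_(z | (z != a) && ~~ P z) (('a_(z, x) - 'a_(z, a)) ^+ 2 + ('a_(z, x) - 'a_(z, b)) ^+ 2)
  = 2 * height x.
  rewrite mulr_sumr; apply: eq_big => [z|z /andP[za /negbTE zb]].
    by have [->|//] := eqVneq z a; rewrite anc_root.
  by rewrite zb anc_rootE (negbTE za); case: (anc z x); rewrite /=; ring.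
have -> : \sum_(z | (z != a) && P z) (('a_(z, x) - 'a_(z, a)) ^+ 2 + ('a_(z, x) - 'a_(z, b)) ^+ 2)
  = \sum_(z | (z != a) && P z) 1.
  apply: eq_bigr => z /andP[za zb].
  by rewrite zb anc_rootE (negbTE za); case: (anc z x); rewrite /=; ring.
by rewrite sum_pathD1; ring.
Qed.

Lemma level_on_path x : x != a -> P x -> level (par x) = level x - 1.
Proof. by move=> xa xb; rewrite (level_par xa) xb addrK. Qed.

(** Discrete integration along the path: the power sums of [level] follow by exhibiting an
    antiderivative [G]. *)
Lemma sum_on_path (F G : V -> R) : F a = G a ->
  (forall x, x != a -> P x -> F x = G x - G (par x)) -> \sum_(x | P x) F x = G b.
Proof.
move=> Fa FG; rewrite sum_pathD1 Fa.
rewrite (eq_bigr (fun x => G x - G (par x))) => [|x /andP[]]; last exact: FG.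
by rewrite telescope addrC subrK.
Qed.

Lemma sum_level : \sum_(x | P x) level x = c * (c + 1) / 2.
Proof.
rewrite -level_end.
apply: (sum_on_path (G := fun x => level x * (level x + 1) / 2)).
  by rewrite level_root; field.
by move=> x xa xb; rewrite level_on_path //; field.
Qed.

Lemma sum_level2 : \sum_(x | P x) level x ^+ 2 = c * (c + 1) * (2 * c + 1) / 6.
Proof.
rewrite -level_end.
apply: (sum_on_path (G := fun x => level x * (level x + 1) * (2 * level x + 1) / 6)).
  by rewrite level_root; field.
by move=> x xa xb; rewrite level_on_path //; field.
Qed.

Lemma sum_level_sq x : \sum_(y | P y) (level x - level y) ^+ 2 =
  c * level x ^+ 2 - c * (c + 1) * level x + c * (c + 1) * (2 * c + 1) / 6.
Proof.
rewrite -sum_level2.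
have -> : c * (c + 1) * level x = \sum_(y | P y) 2 * level y * level x.
  by rewrite -mulr_suml -mulr_sumr sum_level; field.
have -> : c * level x ^+ 2 = \sum_(y | P y) level x ^+ 2.
  by rewrite mulr_suml; apply: eq_bigr => y _; rewrite mul1r.
by rewrite -sumrB -big_split; apply: eq_bigr => y _ /=; ring.
Qed.

(** The path is a chain, so each of its vertices is above or below [z], and only [z] itself is both;
    the two counts sum to [c + 1]. *)
Lemma desc_on_path z : P z -> \sum_(y | P y) 'a_(z, y) = c + 1 - level z.
Proof.
move=> zb.
have one : \sum_(y | P y) (y == z)%:R = 1 :> R.
  by rewrite (bigD1 z) //= eqxx big1 ?addr0 // => y /andP[_ /negbTE->].
rewrite -[X in _ = _ + X - _]one -big_split -sumrB; apply: eq_bigr => y yb /=.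
have := anc_total zb yb; have [->|yz] := eqVneq y z; first by move=> _; rewrite anc_refl /=; ring.
have : ~~ (anc z y && anc y z) by apply: contraNN yz => /andP[zy yz]; apply/eqP/anc_anti.
by case: (anc z y); case: (anc y z) => //= _ _; ring.
Qed.

(** The path vertices below [x] have levels 1, 2, ..., [level x]. *)
Lemma sum_level_below x : \sum_(z | P z) 'a_(z, x) * level z = level x * (level x + 1) / 2.
Proof.
elim/par_ind: x => [|x xa IH].
  rewrite (bigD1 a) ?anc_root //= level_root big1.
    by field.
  by move=> z /andP[_ /negbTE za]; rewrite anc_rootE za mul0r.
have [xb|xb] := boolP (P x); last first.
  rewrite level_par // (negbTE xb) addr0 -IH; apply: eq_bigr => z zb.
  by rewrite (@anc_par_neq z x) //; apply: contraNneq xb => <-.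
have -> : level x * (level x + 1) / 2 = level (par x) * (level (par x) + 1) / 2 + level x.
  by rewrite level_on_path //; field.
rewrite -IH (bigD1 x) //= anc_refl mul1r addrC; congr (_ + _).
rewrite [RHS](bigD1 x) //= anc_par // mul0r add0r.
by apply: eq_bigr => z /andP[_ zx]; rewrite anc_par_neq.
Qed.

(** The distance between the projections of [x] and [y] on the path. *)
Definition pdist x y : R := \sum_(z | P z) ('a_(z, x) - 'a_(z, y)) ^+ 2.

Lemma pdist_ge0 x y : 0 <= pdist x y.
Proof. by apply: sumr_ge0 => z _; exact: sqr_ge0. Qed.

Lemma pdist_sym x y : pdist x y = pdist y x.
Proof. by apply: eq_bigr => z _; rewrite -opprB sqrrN. Qed.

Lemma sum_pdist x : \sum_(y | P y) pdist x y =
  level x ^+ 2 - (c + 1) * level x + c * (c + 1) / 2.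
Proof.
have -> : \sum_(y | P y) pdist x y = \sum_(z | P z) \sum_(y | P y)
    ('a_(z, x) + 'a_(z, y) - 2 * 'a_(z, x) * 'a_(z, y)).
  rewrite exchange_big /=; apply: eq_bigr => z _; apply: eq_bigr => y _.
  by case: (anc z x); case: (anc z y); rewrite /=; ring.
have -> : \sum_(z | P z) \sum_(y | P y) ('a_(z, x) + 'a_(z, y) - 2 * 'a_(z, x) * 'a_(z, y))
  = \sum_(z | P z) ('a_(z, x) * c + (c + 1 - level z) - 2 * ('a_(z, x) * (c + 1) - 'a_(z, x) * level z)).
  apply: eq_bigr => z zb; rewrite sumrB big_split /= -mulr_sumr desc_on_path //.
  rewrite -(mulr1 'a_(z, x)) -mulr_sumr; ring.
rewrite sumrB big_split /= -mulr_suml -/(level x) sumrB -mulr_sumr sumrB -mulr_suml -/(level x).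
rewrite sum_level_below sum_level -(mulr1 (c + 1)) -mulr_sumr mulr1.
by field.
Qed.

Lemma tdist_decomp x y : tdist x y = pdist x y + height x + height y
  - 2 * \sum_(z | ~~ P z) 'a_(z, x) * 'a_(z, y).
Proof.
rewrite /tdist (bigID (fun z => P z)) /= -!addrA; congr (_ + _).
rewrite mulr_sumr -sumrB -big_split; apply: eq_bigr => z _ /=.
by case: (anc z x); case: (anc z y); rewrite /=; ring.
Qed.

Definition desc z : R := \sum_x 'a_(z, x).

Lemma sum_height : \sum_x height x = \sum_(z | ~~ P z) desc z.
Proof. exact: exchange_big. Qed.

Lemma sum_tdist : \sum_x \sum_y tdist x y =
  2 * n * (\sum_x height x) - 2 * \sum_(z | ~~ P z) desc z ^+ 2 + \sum_x \sum_y pdist x y.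
Proof.
under eq_bigr do under eq_bigr do rewrite tdist_decomp.
under eq_bigr do rewrite sumrB !big_split /= -mulr_sumr.
rewrite sumrB !big_split /= -mulr_sumr.
under [X in _ + X + _ - _]eq_bigr do rewrite sumr_const -mulr_natr.
rewrite -mulr_suml [X in _ + _ + X - _]sumr_const -mulr_natr.
have -> : \sum_x \sum_y \sum_(z | ~~ P z) 'a_(z, x) * 'a_(z, y) = \sum_(z | ~~ P z) desc z ^+ 2.
  under eq_bigr do rewrite exchange_big.
  rewrite exchange_big /=; apply: eq_bigr => z _.
  by rewrite expr2 mulr_suml; apply: eq_bigr => x _; rewrite mulr_sumr.
by ring.
Qed.

(** * Degree-weighted distance sums in the tree and in the graph with the added edge *)

Hypotheses (ab_neq : a != b) (nab : ~~ e a b).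

Lemma deg_tree_gt0 x : (0 < deg e x)%N.
Proof.
have [y yx] : exists y, y != x.
  by have [->|xa] := eqVneq x a; [exists b; rewrite eq_sym | exists a; rewrite eq_sym].
have /connectP[[|z s] /= ps yE] := e_tree.1 x y; first by rewrite yE eqxx in yx.
by apply/card_gt0P; exists z; rewrite inE; case/andP: ps.
Qed.

Lemma deg_cycle_gt0 x : (0 < deg (add_edge e a b) x)%N.
Proof.
have := deg_tree_gt0 x; have := deg_add_edge R e_sym ab_neq nab x.
rewrite -!natrD => /eqP; rewrite eqr_nat => /eqP ->.
by move=> d0; rewrite -addnA ltn_addr.
Qed.

Lemma height_on_path x : P x -> height x = 0.
Proof.
move=> xb; apply: big1 => z zb; case: (boolP (anc z x)) => // zx.
by rewrite (anc_trans zx xb) in zb.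
Qed.

Lemma tdist_ends : tdist a b = c - 1.
Proof.
by have := tdist_sum a; rewrite tdistxx (height_on_path (anc_root b)) mulr0 !add0r.
Qed.

Lemma c_gt0 : 0 < c.
Proof. by rewrite sum_pathD1 ltr_pwDl // sumr_ge0. Qed.

Local Notation S := (\sum_x \sum_y tdist x y).
Local Notation H := (\sum_x height x).
Local Notation L := (\sum_x \sum_y (level x - level y) ^+ 2).

Lemma level_off_path x : x != a -> ~~ P x -> level x = level (par x).
Proof. by move=> xa xb; rewrite (level_par xa) (negbTE xb) addr0. Qed.

Lemma deg_tdist_sum : \sum_x \sum_y (deg e x)%:R * (deg e y)%:R * tdist x y =
  4 * S - 2 * (n - 1) * (2 * n - 1).
Proof.
have -> : \sum_x \sum_y (deg e x)%:R * (deg e y)%:R * tdist x y =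
   \sum_x (2 * (\sum_y (deg e x)%:R * tdist x y) - (deg e x)%:R * (n - 1)).
  apply: eq_bigr => x _.
  transitivity ((deg e x)%:R * (\sum_y (deg e y)%:R * tdist y x)).
    by rewrite mulr_sumr; apply: eq_bigr => y _; rewrite mulrA (tdist_sym x y).
  rewrite sum_deg_tdist mulrBr mulrCA; congr (_ * _ - _).
  by rewrite mulr_sumr; apply: eq_bigr => y _; rewrite (tdist_sym x y).
rewrite sumrB -mulr_sumr -mulr_suml sum_deg1 exchange_big /=.
under eq_bigr do rewrite sum_deg_tdist.
rewrite sumrB -mulr_sumr sumr_const -[_ *+ #|V|]mulr_natr exchange_big /=.
by ring.
Qed.

Local Notation deg' x := ((deg (add_edge e a b) x)%:R : R).

Lemma sum_deg'E (g : V -> R) :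
  \sum_x deg' x * g x = \sum_x (deg e x)%:R * g x + g a + g b.
Proof.
under eq_bigr do rewrite (deg_add_edge R e_sym ab_neq nab) !mulrDl.
by rewrite !big_split /= !sum_indr.
Qed.

(** The new edge supplies exactly the two half-edges missing in [sum_deg_level]. *)
Lemma sum_deg'_level (g : V -> R) : (forall x, x != a -> ~~ P x -> g x = g (par x)) ->
  \sum_x deg' x * g x = 2 * (\sum_x g x).
Proof. by move=> gP; rewrite sum_deg'E sum_deg_level //; ring. Qed.

Lemma sum_deg'_tdist x : \sum_y deg' y * tdist y x =
  2 * (\sum_y tdist y x) - (n - 1) + (tdist x a + tdist x b).
Proof. by rewrite sum_deg'E sum_deg_tdist (tdist_sym x a) (tdist_sym x b) addrA. Qed.

Lemma deg'_tdist_sum : \sum_x \sum_y deg' x * deg' y * tdist x y =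
  4 * S + 4 * (2 * H + n * (c - 1)) - 4 * n * (n - 1) - 2 * (n - 1) + 2 * (c - 1).
Proof.
have ends : \sum_x (tdist x a + tdist x b) = 2 * H + n * (c - 1).
  under eq_bigr do rewrite tdist_sum -addrA.
  by rewrite big_split /= -mulr_sumr [X in _ + X]sumr_const -[_ *+ #|V|]mulr_natl.
have -> : \sum_x \sum_y deg' x * deg' y * tdist x y =
   2 * (\sum_y \sum_x deg' x * tdist x y) - (\sum_x deg' x * (n - 1))
   + \sum_x deg' x * tdist x a + \sum_x deg' x * tdist x b.
  rewrite [in RHS]exchange_big mulr_sumr -sumrB -!big_split /=; apply: eq_bigr => x _.
  transitivity (deg' x * (\sum_y deg' y * tdist y x)).
    by rewrite mulr_sumr; apply: eq_bigr => y _; rewrite (tdist_sym x y); ring.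
  rewrite sum_deg'_tdist.
  have -> : \sum_y deg' x * tdist x y = deg' x * \sum_y tdist y x.
    by rewrite mulr_sumr; apply: eq_bigr => y _; rewrite (tdist_sym x y).
  by ring.
rewrite (eq_bigr _ (fun y _ => sum_deg'_tdist y)) !sum_deg'_tdist !(tdistxx, tdist_sym b a) tdist_ends.
rewrite (@sum_deg'_level (fun=> n - 1)) // sumr_const -[_ *+ #|V|]mulr_natr.
rewrite big_split sumrB /= -mulr_sumr ends sumr_const -[_ *+ #|V|]mulr_natr exchange_big /=.
have : \sum_x tdist x a + \sum_x tdist x b = 2 * H + n * (c - 1) by rewrite -big_split.
by lra.
Qed.

Lemma deg'_level_sum :
  \sum_x \sum_y deg' x * deg' y * (level x - level y) ^+ 2 = 4 * L.
Proof.
have E z : \sum_y deg' y * (level z - level y) ^+ 2 = 2 * \sum_y (level z - level y) ^+ 2.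
  by apply: (@sum_deg'_level (fun y => _)) => x xa xb; rewrite (level_off_path xa xb).
have -> : \sum_x \sum_y deg' x * deg' y * (level x - level y) ^+ 2 =
   \sum_x deg' x * (2 * \sum_y (level x - level y) ^+ 2).
  by apply: eq_bigr => x _; rewrite -E mulr_sumr; apply: eq_bigr => y _; ring.
rewrite sum_deg'_level => [|x xa xb]; last by rewrite (level_off_path xa xb).
by rewrite -mulr_sumr; ring.
Qed.

(** * Closed forms of the two Kemeny constants *)

Variables (wT wG : V -> R).
Hypotheses (wT_stat : stationary e wT) (wG_stat : stationary (add_edge e a b) wG).

Lemma kemeny_tree j :
  kemeny e wT j = (4 * S - 2 * (n - 1) * (2 * n - 1)) / (4 * (n - 1)).
Proof.
rewrite (kemenyE e_sym tdist_resistance deg_tree_gt0 j wT_stat) deg_tdist_sum sum_deg1.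
by congr (_ / _); ring.
Qed.

Lemma kemeny_cycle j : kemeny (add_edge e a b) wG j =
  (4 * S + 4 * (2 * H + n * (c - 1)) - 4 * n * (n - 1) - 2 * (n - 1) + 2 * (c - 1)
   - 4 * L / c) / (4 * n).
Proof.
have c0 : c != 0 by rewrite gt_eqF ?c_gt0.
have ab1 : 1 + tdist a b = c by rewrite tdist_ends addrC subrK.
have ab10 : 1 + tdist a b != 0 by rewrite ab1.
have res := add_edge_resistance e_sym ab_neq nab tdist_sym tdist_resistance ab10.
rewrite (kemenyE (add_edge_sym a b e_sym) res deg_cycle_gt0 j wG_stat) ab1.
have -> : \sum_x deg' x = 2 * n.
  have := @sum_deg'_level (fun=> 1) (fun _ _ _ => erefl).
  by under eq_bigr do rewrite mulr1; rewrite sum_one.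
have -> : 2 * (2 * n) = 4 * n by ring.
congr (_ / _); rewrite -deg'_tdist_sum -deg'_level_sum mulr_suml -sumrB.
apply: eq_bigr => x _; rewrite mulr_suml -sumrB; apply: eq_bigr => y _.
by rewrite /potential !tdist_diff; field.
Qed.

(** * The gap to the bound as a sum of nonnegative terms *)

Local Notation O x := (~~ anc x b).
Local Notation k := (\sum_(x | O x) (1 : R)).
Local Notation T :=
  (\sum_(z | O z) ((\sum_(x | O x) 'a_(z, x)) ^+ 2 - \sum_(x | O x) 'a_(z, x))).
Local Notation dist2 x y := (pdist x y + (n - 1) / c * (level x - level y) ^+ 2).

(** Used with [eps] equal to 0 for odd and 1 for even path size, a lower bound of
    [(2 * level x - 1 - c) ^+ 2] attained at the middle levels. *)
Definition excess (eps : R) : R := 2 * ((k ^+ 3 - k) / 3 - T)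
  + n / 2 * \sum_(x | O x) ((2 * level x - 1 - c) ^+ 2 - eps)
  + \sum_(x | O x) \sum_(y | O y) dist2 x y.

Lemma k_def : k = n - c.
Proof. by rewrite -sum_one [in RHS](bigID (fun x => anc x b)) /= addrC addrK. Qed.

(** Descendants of an off-path vertex are off the path, so restricting the count to [O] loses
    nothing. *)
Lemma sum_off_path : T = \sum_(z | O z) desc z ^+ 2 - H.
Proof.
rewrite sum_height -sumrB; apply: eq_bigr => z zb.
suff -> : \sum_(x | O x) 'a_(z, x) = desc z by [].
rewrite big_mkcond; apply: eq_bigr => x _; case: ifPn => //; rewrite negbK => xb.
by case: (boolP (anc z x)) => // zx; rewrite (anc_trans zx xb) in zb.
Qed.

(** Pairs are split by whether each vertex is on the path. Summing over path vertices leaves a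
    quadratic in [level], which is completed to a square; only pairs with both vertices off the path
    stay unevaluated. *)
Lemma sum_dist2 eps : \sum_x \sum_y pdist x y + (n - 1) / c * L =
   n * (c * (c + 1) * (2 * c + 1) / 6 - c * (c + 1) ^+ 2 / 2)
   + (c + 2 * k) * (c * (c + 1) / 2 + (n - 1) * (c + 1) * (2 * c + 1) / 6)
   + n / 2 * \sum_(x | O x) ((2 * level x - 1 - c) ^+ 2 - eps)
   - n / 2 * k * ((c + 1) ^+ 2 - eps)
   + \sum_(x | O x) \sum_(y | O y) dist2 x y.
Proof.
have c0 : c != 0 by rewrite gt_eqF ?c_gt0.
have dist2_sym x y : dist2 x y = dist2 y x.
  by rewrite pdist_sym -[level x - level y]opprB sqrrN.
have on_path x : \sum_(y | P y) dist2 x y = n * (level x ^+ 2 - (c + 1) * level x)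
    + (c * (c + 1) / 2 + (n - 1) * (c + 1) * (2 * c + 1) / 6).
  by rewrite big_split /= -mulr_sumr sum_pdist sum_level_sq; field.
have -> : \sum_x \sum_y pdist x y + (n - 1) / c * L = \sum_x \sum_y dist2 x y.
  by rewrite mulr_sumr -big_split; apply: eq_bigr => x _; rewrite mulr_sumr -big_split.
have -> : \sum_x \sum_y dist2 x y = \sum_(x | P x) \sum_(y | P y) dist2 x y
    + 2 * (\sum_(x | O x) \sum_(y | P y) dist2 x y) + \sum_(x | O x) \sum_(y | O y) dist2 x y.
  under eq_bigr do rewrite (bigID (fun y => P y)) /=.
  rewrite (bigID (fun x => P x)) /= !big_split /=.
  rewrite [X in _ + X + _](_ : _ = \sum_(x | O x) \sum_(y | P y) dist2 x y); first by ring.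
  by rewrite exchange_big; apply: eq_bigr => x _; apply: eq_bigr => y _.
congr (_ + _).
set U := c * (c + 1) / 2 + (n - 1) * (c + 1) * (2 * c + 1) / 6 in on_path *.
have sums (Q : pred V) : \sum_(x | Q x) \sum_(y | P y) dist2 x y =
    n * (\sum_(x | Q x) level x ^+ 2 - (c + 1) * \sum_(x | Q x) level x)
    + (\sum_(x | Q x) 1) * U.
  rewrite mulr_sumr -sumrB mulr_sumr mulr_suml -big_split; apply: eq_bigr => x _ /=.
  by rewrite on_path mul1r.
rewrite !sums sum_level sum_level2.
have -> : \sum_(x | O x) ((2 * level x - 1 - c) ^+ 2 - eps) =
   4 * (\sum_(x | O x) level x ^+ 2) - 4 * (c + 1) * (\sum_(x | O x) level x)
   + k * ((c + 1) ^+ 2 - eps).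
  rewrite !mulr_sumr mulr_suml -sumrB -big_split; apply: eq_bigr => x _ /=; ring.
by field.
Qed.

Lemma kemeny_gap (m : nat) j j' : c = m%:R ->
  bound31 R #|V| m - (kemeny (add_edge e a b) wG j - kemeny e wT j') =
  excess (~~ odd m)%:R / (n * (n - 1)).
Proof.
move=> cm; have c0 : c != 0 by rewrite gt_eqF ?c_gt0.
have n1 : 1 < n.
  rewrite -[1]/(1%:R) ltr_nat; apply/card_gt1P; exists a, b.
  by rewrite !inE.
have n0 : n != 0 by rewrite gt_eqF // (lt_trans ltr01).
have n10 : n - 1 != 0 by rewrite subr_eq0 gt_eqF.
rewrite kemeny_tree kemeny_cycle /excess /bound31 -cm.
have -> : 8 * (n - c) * (- n * c * (m.+1./2)%:R * (m.+2./2)%:R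
     + c * (c + 1) / 6 * ((2 * n + 1) * c + n - 1)) =
  8 * (n - c) * (- n * c * (((c + 1) ^+ 2 - (~~ odd m)%:R) / 4)
     + c * (c + 1) / 6 * ((2 * n + 1) * c + n - 1)).
  by rewrite cm -half_mul_half !mulrA.
have := sum_dist2 (~~ odd m)%:R.
rewrite sum_tdist sum_off_path k_def.
(* The sums become independent atoms, and the identity of [sum_dist2] is solved for the sum of
   [pdist]; a rational identity remains. *)
move: (\sum_(x | O x) \sum_(y | O y) dist2 x y) (~~ odd m)%:R => W eps.
move: (\sum_(x | O x) ((2 * level x - 1 - c) ^+ 2 - eps)) => U.
move: (\sum_x \sum_y pdist x y) L H (\sum_(z | O z) desc z ^+ 2) => D LL HH Q.
move: c c0 {cm} n n0 n10 {n1} => C C0 N N0 N10.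
move/(canRL (addrK _)) => ->.
by field; rewrite C0 N0 N10.
Qed.


Lemma dist2_ge0 x y : 0 <= dist2 x y.
Proof.
rewrite addr_ge0 ?pdist_ge0 // mulr_ge0 ?sqr_ge0 // divr_ge0 ?(ltW c_gt0) //.
by rewrite subr_ge0 (ler_nat _ 1); apply/card_gt0P; exists a.
Qed.

Lemma excess_ge0 eps : (forall x, eps <= (2 * level x - 1 - c) ^+ 2) ->
  0 <= excess eps /\
  (excess eps = 0 <-> [/\ forall x y, O x -> O y -> anc x y || anc y x,
     forall x, O x -> (2 * level x - 1 - c) ^+ 2 = eps &
     forall x y, O x -> O y -> dist2 x y = 0]).
Proof.
move=> eps_le.
have [T_le T_eq] := @chain_triples R V (fun x => O x) anc anc_refl anc_anti
  (fun y x z => @anc_trans y x z).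
have n0 : 0 < n by rewrite ltr0n; apply/card_gt0P; exists a.
have U_ge0 : 0 <= \sum_(x | O x) ((2 * level x - 1 - c) ^+ 2 - eps).
  by apply: sumr_ge0 => x _; rewrite subr_ge0.
have W_ge0 : 0 <= \sum_(x | O x) \sum_(y | O y) dist2 x y.
  by apply: sumr_ge0 => x _; apply: sumr_ge0 => y _; exact: dist2_ge0.
have nU_ge0 : 0 <= n / 2 * \sum_(x | O x) ((2 * level x - 1 - c) ^+ 2 - eps).
  by rewrite mulr_ge0 // divr_ge0 // ltW.
rewrite /excess; split; first by lra.
split=> [E|[chain mid flat]]; last first.
  have -> : T = (k ^+ 3 - k) / 3 by exact/T_eq.
  rewrite subrr [X in n / 2 * X]big1 => [|x xO]; last by rewrite mid // subrr.
  rewrite big1 ?mulr0 ?addr0 // => x xO; apply: big1 => y yO; exact: flat.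
have W0 : \sum_(x | O x) \sum_(y | O y) dist2 x y = 0 by lra.
have TE : T = (k ^+ 3 - k) / 3 by lra.
have /eqP : n / 2 * \sum_(x | O x) ((2 * level x - 1 - c) ^+ 2 - eps) = 0 by lra.
rewrite mulf_eq0 gt_eqF ?divr_gt0 //= => /eqP U0.
split; first exact/T_eq.
- move=> x xO; apply/eqP; rewrite -subr_eq0; apply/eqP.
  by apply: (psumr_eq0P _ U0 xO) => y _; rewrite subr_ge0.
- move=> x y xO yO.
  have Wx : \sum_(z | O z) dist2 x z = 0.
    apply: (psumr_eq0P _ W0 xO) => z _.
    by apply: sumr_ge0 => ? _; exact: dist2_ge0.
  by apply: (psumr_eq0P _ Wx yO) => z _; exact: dist2_ge0.
Qed.

(** The natural-number form of [level], for the parity arguments. *)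
Definition levelN x : nat := #|[pred z | P z && anc z x]|.

Lemma levelE x : level x = (levelN x)%:R.
Proof.
rewrite /level /levelN -sum1_card natr_sum big_mkcondr.
by apply: eq_bigr => z _; case: (anc z x).
Qed.

(** For even [m] the base is an odd integer, so its square is at least 1. *)
Lemma sq_odd_ge (l m : nat) : (~~ odd m)%:R <= (2 * l%:R - 1 - m%:R) ^+ 2 :> R.
Proof.
have [om|om] /= := boolP (odd m); first exact: sqr_ge0.
have [h|h] : (m.+1 < 2 * l \/ 2 * l <= m)%N by lia.
  by have : m%:R + 2 <= 2 * l%:R :> R; [rewrite -natrD -natrM ler_nat; lia | nra].
by have : 2 * l%:R <= m%:R :> R; [rewrite -natrM ler_nat; lia | nra].
Qed.

Lemma sq_odd_eq (l m : nat) : (2 * l%:R - 1 - m%:R) ^+ 2 = (~~ odd m)%:R :> R <->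
  (odd m /\ l = m./2.+1) \/ (~~ odd m /\ (l = m./2 \/ l = m./2.+1)).
Proof.
have E : 2 * l%:R - 1 - m%:R = (2 * l%:Z - 1 - m%:Z)%:~R :> R.
  by rewrite !intrB intrM.
have -> : (~~ odd m)%:R = (~~ odd m)%:Z%:~R :> R by [].
rewrite E -rmorphXn; split=> [/intr_inj|h]; last by congr _%:~R; nia.
nia.
Qed.

Lemma pdist_eq0 x y : pdist x y = 0 <-> forall z, P z -> anc z x = anc z y.
Proof.
split=> [E z zb|E]; last by apply: big1 => z zb; rewrite E // subrr expr0n.
have /eqP : ('a_(z, x) - 'a_(z, y)) ^+ 2 = 0.
  by apply: (psumr_eq0P _ E zb) => ? _; exact: sqr_ge0.
by rewrite sqrf_eq0 subr_eq0 eqr_nat; case: (anc z x); case: (anc z y).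
Qed.

Lemma dist2_eq0 x y : dist2 x y = 0 <-> forall z, P z -> anc z x = anc z y.
Proof.
split=> [E|E].
  apply/pdist_eq0/eqP; rewrite eq_le pdist_ge0 andbT -E lerDl mulr_ge0 ?sqr_ge0 //.
  rewrite divr_ge0 ?(ltW c_gt0) // subr_ge0 (ler_nat _ 1).
  by apply/card_gt0P; exists a.
have -> : level x = level y by apply: eq_bigr => z /E ->.
by rewrite (pdist_eq0 x y).2 // add0r subrr expr0n mulr0.
Qed.

(** * The equality case: a tail attached at the middle of the path *)

Variable p : seq V.
Hypotheses (p_path : path e a p) (p_last : last a p = b) (p_uniq : uniq (a :: p)).

Lemma mem_path z : P z = (z \in a :: p).
Proof. by rewrite -p_last anc_last. Qed.

Lemma c_size : c = (size (a :: p))%:R.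
Proof.
rewrite -(card_uniqP p_uniq) sumr_const; congr (_ *+ _).
by apply: eq_card => z; rewrite [LHS]mem_path.
Qed.

Lemma nth_path_last i : (i < size (a :: p))%N -> nth a (a :: p) i = last a (take i p).
Proof.
move=> ip; rewrite (last_nth a) size_takel // -[a :: take i p]/(take i.+1 (a :: p)).
by rewrite nth_take.
Qed.

Lemma anc_nth i z : (i < size (a :: p))%N ->
  anc z (nth a (a :: p) i) = (z \in take i.+1 (a :: p)).
Proof.
move=> ip; rewrite nth_path_last // anc_last //; first exact: take_path.
by rewrite -[a :: take i p]/(take i.+1 (a :: p)) take_uniq.
Qed.

Lemma levelN_nth i : (i < size (a :: p))%N -> levelN (nth a (a :: p) i) = i.+1.
Proof.
move=> ip; rewrite -(size_takel ip) -(card_uniqP (take_uniq _ p_uniq)).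
apply: eq_card => z; rewrite !inE anc_nth // mem_path andb_idl //.
exact: mem_take.
Qed.

Lemma edge_path_edge s x : path e a s -> uniq (a :: s) -> x \in s ->
  path_edge (a :: s) x (par x).
Proof.
move=> ps us /splitPr xs; case: xs ps us => s1 s2 ps us.
suff -> : par x = last a s1 by exact: path_edge_last.
by apply: (par_path (s := belast a s1) (t := s2) ps us); rewrite -cat_cons lastI cat_rcons.
Qed.

Lemma size_path_le : (size (a :: p) <= #|V|)%N.
Proof. by rewrite -(card_uniqP p_uniq) max_card. Qed.

(** The main path cut after index [m] and continued by [q] is one simple path from the root, to
    which [anc_last] and [par_path] apply. *)
Lemma path_with_tail m q : (m < size (a :: p))%N -> uniq ((a :: p) ++ q) ->
  path e (nth a (a :: p) m) q ->
  path e a (take m p ++ q) /\ uniq (a :: take m p ++ q).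
Proof.
move=> mp uq pq; split; first by rewrite cat_path take_path //= -nth_path_last.
apply: subseq_uniq uq; rewrite -cat_cons; apply: cat_subseq => //.
exact: (take_subseq (a :: p) m.+1).
Qed.

Lemma tail_of_path m q : (m < size (a :: p))%N ->
  uniq ((a :: p) ++ q) -> size q = (#|V| - size (a :: p))%N ->
  path e (nth a (a :: p) m) q ->
  [/\ forall x y, O x -> O y -> anc x y || anc y x,
      forall x, O x -> levelN x = m.+1 &
      forall x y, O x -> O y -> forall z, P z -> anc z x = anc z y].
Proof.
move=> mp uq sq pq; set v := nth a (a :: p) m in pq *.
(* By counting: a vertex outside both the path and [q] would give more than [#|V|] distinct
   vertices. *)
have Oq x : O x -> x \in q.
  move=> xO; apply: contraT => xq; have : uniq (x :: (a :: p) ++ q).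
    by rewrite cons_uniq uq andbT mem_cat negb_or -mem_path xO.
  move/card_uniqP => E; have := max_card (mem (x :: (a :: p) ++ q)); rewrite E.
  by rewrite -[size _]/(size ((a :: p) ++ q)).+1 size_cat sq subnKC ?size_path_le // ltnn.
have ancx x z : x \in q -> P z -> anc z x = anc z v.
  move=> xq zb; have [q1 [q2 qE]] : exists q1 q2, q = rcons q1 x ++ q2.
    by case/path.splitP: xq => q1 q2; exists q1, q2.
  have u1 : uniq ((a :: p) ++ rcons q1 x).
    by move: uq; rewrite qE catA cat_uniq => /andP[].
  have p1 : path e v (rcons q1 x) by move: pq; rewrite qE cat_path => /andP[].
  have [pp uu] := path_with_tail mp u1 p1.
  have := anc_last z pp uu; rewrite last_cat last_rcons => ->.
  rewrite anc_nth // -cat_cons mem_cat -[a :: take m p]/(take m.+1 (a :: p)).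
  rewrite orb_idr // => zq; have : z \in a :: p by rewrite -mem_path.
  by move: u1; rewrite cat_uniq => /and3P[_ /hasPn/(_ _ zq)/negbTE/= -> _].
have [pp uu] := path_with_tail mp uq pq.
split=> [x y /Oq xq /Oq yq|x /Oq xq|x y /Oq xq /Oq yq z zb].
- by apply: (@anc_total _ _ (last a (take m p ++ q))); rewrite anc_last // inE mem_cat ?xq ?yq !orbT.
- rewrite -(levelN_nth mp); apply: eq_card => z; rewrite !inE.
  by case: (boolP (P z)) => //= zb; rewrite ancx.
- by rewrite (ancx x) // (ancx y).
Qed.

Lemma path_of_tail l : (forall x y, O x -> O y -> anc x y || anc y x) ->
  (forall x, O x -> levelN x = l) -> forall x0, O x0 ->
  exists2 m, (m < size (a :: p))%N /\ l = m.+1 & exists q,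
    [/\ path e (nth a (a :: p) m) q, uniq ((a :: p) ++ q) & forall x, (x \in q) = O x].
Proof.
move=> chain lev x0 x0O.
(* [f] is the shallowest and [g] the deepest off-path vertex: the parent of [f] is the attachment
   point, and the root path of [g] beyond it is the tail. *)
case: (@arg_minnP V x0 (fun x => O x) depth x0O) => f fO fmin.
case: (@arg_maxnP V x0 (fun x => O x) depth x0O) => g gO gmax.
have fg : anc f g.
  have /orP[//|/anc_depth[->|gf]] := chain f g fO gO; first exact: anc_refl.
  by have := leq_trans gf (fmin g gO); rewrite ltnn.
have toO x : O x -> anc x g.
  move=> xO; have /orP[//|/anc_depth[->|gx]] := chain x g xO gO; first exact: anc_refl.
  by have := leq_trans gx (gmax x xO); rewrite ltnn.
have fa : f != a by apply: contraNneq fO => ->; exact: anc_root.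
have parf : P (par f).
  by apply: contraT => pO; have := leq_trans (parP fa).2 (fmin _ pO); rewrite ltnn.
have levf : levelN (par f) = l.
  by apply/eqP; rewrite -(lev f fO) -(eqr_nat R) -!levelE -level_off_path.
move: (parf); rewrite mem_path => pm; set m := index (par f) (a :: p).
have mp : (m < size (a :: p))%N by rewrite index_mem.
have mE : nth a (a :: p) m = par f by rewrite nth_index.
exists m; first by split=> //; rewrite -levf -mE levelN_nth.
have pg : anc (par f) g by apply: anc_trans fg; rewrite ancE anc_refl orbT.
rewrite mE.
have /connectP[s0 ps0 gE] := e_tree.1 a g.
case: (shortenP ps0) gE => u pu uu _ gE.
have /splitPl ug : par f \in a :: u by rewrite -(anc_last _ pu uu) -gE.
case: ug gE pu uu => u1 q u1E gE pu uu.
have ancu z : anc z g = (z \in a :: u1) || (z \in q).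
  by rewrite gE anc_last // -cat_cons mem_cat.
have [pu1 pq] : path e a u1 /\ path e (par f) q.
  by move: pu; rewrite cat_path u1E => /andP.
have [uu1 u1q uq] : [/\ uniq (a :: u1), forall z, z \in q -> z \notin a :: u1 & uniq q].
  by move: uu; rewrite -cat_cons cat_uniq => /and3P[? /hasPn ? ?].
have ancf z : anc z (par f) = (z \in a :: u1) by rewrite -u1E anc_last.
(* A path vertex in [q] would be an ancestor of [g] but not of [par f], contradicting the equality
   of their levels. *)
have qO x : (x \in q) = O x.
  apply/idP/idP => [xq|xO].
    apply/negP => xb; have xg : anc x g by rewrite ancu xq orbT.
    have /negP := u1q x xq; rewrite -ancf; apply.
    have : levelN (par f) = levelN g by rewrite levf lev.
    rewrite /levelN => /esym/eqP E.
    have sub : [pred z | P z && anc z (par f)] \subset [pred z | P z && anc z g].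
      by apply/fintype.subsetP => z; rewrite !inE => /andP[-> zf]; exact: anc_trans zf pg.
    have := subset_cardP (esym (eqP E)) sub x.
    by rewrite !inE xb xg.
  have := toO x xO; rewrite ancu => /orP[|//]; rewrite -ancf => xf.
  by rewrite (anc_trans xf parf) in xO.
exists q; split=> //; rewrite cat_uniq p_uniq uq andbT /=.
by apply/hasPn => z; rewrite qO => zO; rewrite /= -mem_path.
Qed.

(** Edges are parent links, and every non-root vertex lies on the path or on the tail, where its
    parent is its predecessor. *)
Lemma edge_of_tail m q : (m < size (a :: p))%N -> uniq ((a :: p) ++ q) ->
  path e (nth a (a :: p) m) q -> (forall x, O x -> x \in q) ->
  forall x y, e x y = path_edge (a :: p) x y || path_edge (nth a (a :: p) m :: q) x y.
Proof.
move=> mp uq pq Oq; set v := nth a (a :: p) m in pq *.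
have par_edge x : x != a -> path_edge (a :: p) x (par x) || path_edge (v :: q) x (par x).
  move=> xa; apply/orP; case: (boolP (P x)) => [xp|/Oq xq]; [left|right].
    by move: xp; rewrite mem_path inE (negbTE xa); exact: edge_path_edge.
  have [pp uu] := path_with_tail mp uq pq.
  case/splitPr: xq uq pq pp uu => q1 q2 uq pq pp uu.
  suff -> : par x = last v q1 by exact: path_edge_last.
  apply: (par_path (s := belast a (take m p ++ q1)) (t := q2) pp uu).
  by rewrite /v nth_path_last // -last_cat -[RHS]cat_rcons -lastI cat_cons catA.
move=> x y; apply/idP/orP => [|[]].
- rewrite edge_par => /orP[/andP[xa /eqP ->]|/andP[ya /eqP ->]]; first exact/orP/par_edge.
  by rewrite !(path_edge_sym _ (par y)); exact/orP/par_edge.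
- exact: path_edge_sub.
- exact: path_edge_sub.
Qed.

Let m0 := size (a :: p).

Lemma level_sq_ge x : (~~ odd m0)%:R <= (2 * level x - 1 - c) ^+ 2.
Proof. by rewrite levelE c_size sq_odd_ge. Qed.

Lemma excess_eq0 : excess (~~ odd m0)%:R = 0 <->
  exists (m : nat) (q : seq V),
     [/\ (odd m0 /\ m = m0./2) \/ (~~ odd m0 /\ (m = m0./2 - 1 \/ m = m0./2))%N,
         uniq ((a :: p) ++ q), size q = (#|V| - m0)%N &
         forall x y, e x y =
           path_edge (a :: p) x y || path_edge (nth a (a :: p) m :: q) x y].
Proof.
have m0_gt0 : (0 < m0)%N by [].
apply: (iff_trans (excess_ge0 level_sq_ge).2).
split=> [[chain mid flat]|[m [q [mP uq sq eE]]]]; last first.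
  have mp : (m < m0)%N by lia.
  have pq : path e (nth a (a :: p) m) q.
    by apply: path_edge_path => x y xy; rewrite eE xy orbT.
  have [chain lev same] := tail_of_path mp uq sq pq.
  split=> // [x xO|x y xO yO]; last by apply/dist2_eq0; exact: same.
  by rewrite levelE lev // c_size; apply/sq_odd_eq; rewrite -/m0; lia.
(* With no vertex off the path, the tree is the path itself and the empty tail is attached at a
   middle vertex. *)
case: (pickP (fun x => O x)) => [x0 x0O|noO]; last first.
  exists m0./2, [::]; rewrite cats0 p_uniq; split=> //.
  - by case: (odd m0); [left | right; split=> //; right].
  - suff -> : m0 = #|V| by rewrite subnn.
    rewrite /m0 -(card_uniqP p_uniq); apply: eq_card => x.
    by rewrite -mem_path; have /negbFE := noO x.
  - apply: edge_of_tail => //; rewrite ?cats0 //; first by rewrite -/m0; lia.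
    by move=> x xO; rewrite noO in xO.
have lev x : O x -> levelN x = levelN x0.
  move=> xO; apply/eqP; rewrite -(eqr_nat R) -!levelE; apply/eqP.
  by apply: eq_bigr => z zb; rewrite ((dist2_eq0 x x0).1 (flat x x0 xO x0O) z zb).
have [m [mp l0] [q [pq uq qO]]] := path_of_tail chain lev x0O.
exists m, q; split=> //.
(* Levels count from 1 and indices from 0, which turns the middle levels into the stated indices. *)
- have := mid x0 x0O; rewrite levelE c_size l0 => /sq_odd_eq; rewrite -/m0; lia.
- have /card_uniqP <- : uniq q by move: uq; rewrite cat_uniq => /and3P[].
  rewrite /m0 -(card_uniqP p_uniq) -(cardC (mem (a :: p))) addKn.
  by apply: eq_card => x; rewrite [LHS]qO mem_path.
- by apply: edge_of_tail => // x xO; rewrite qO.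
Qed.

End RootedTree.

Theorem theorem3p1 (R : realType) (V : finType) (e : rel V)
  (e_sym : symmetric e) (e_irr : irreflexive e) (e_tree : is_tree e)
  (n_ge4 : (4 <= #|V|)%N)
  (v1 vc : V) (v1_neq_vc : v1 != vc) (v1_vc_nonadj : ~~ e v1 vc)
  (p : seq V) (p_path : path e v1 p) (p_last : last v1 p = vc)
  (p_uniq : uniq (v1 :: p))
  (wT wG : V -> R) (wT_stat : stationary e wT)
  (wG_stat : stationary (add_edge e v1 vc) wG) (j j' : V) :
  let n := #|V| in
  let c := size (v1 :: p) in
  let KG := kemeny (add_edge e v1 vc) wG j in
  let KT := kemeny e wT j' in
  KG - KT <= bound31 R n c /\
  (KG - KT = bound31 R n c <->
   exists (m : nat) (q : seq V),
     [/\ (odd c /\ m = c./2) \/ (~~ odd c /\ (m = c./2 - 1 \/ m = c./2))%N,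
         uniq ((v1 :: p) ++ q), size q = (n - c)%N &
         forall x y, e x y =
           path_edge (v1 :: p) x y || path_edge (nth v1 (v1 :: p) m :: q) x y]).
Proof.
move=> n c KG KT.
have cE := c_size e_sym e_irr e_tree R p_path p_last p_uniq.
(* Both claims are read off from this identity, whose right side is [excess] divided by the positive
   number n(n-1). *)
have gap : bound31 R n c - (KG - KT) = _ :=
  kemeny_gap e_sym e_irr v1_neq_vc v1_vc_nonadj wT_stat wG_stat j j' cE.
have [ex_ge0 _] := excess_ge0 e_sym
  (level_sq_ge e_sym e_irr e_tree R v1_neq_vc v1_vc_nonadj p_path p_last p_uniq).
have N_gt0 : 0 < (n%:R : R) * (n%:R - 1).
  have n_gt1 : (1 < n)%N by apply: leq_trans n_ge4.
  by rewrite mulr_gt0 ?subr_gt0 ?ltr1n // ltr0n ltnW.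
split; first by rewrite -subr_ge0 gap divr_ge0 // ltW.
apply: iff_trans (excess_eq0 e_sym e_irr e_tree R v1_neq_vc v1_vc_nonadj p_path p_last p_uniq).
split=> [E|E].
  move: gap; rewrite E subrr => /esym/eqP.
  by rewrite mulf_eq0 invr_eq0 [X in _ || X]gt_eqF // orbF => /eqP.
by apply/esym/eqP; rewrite -subr_eq0 gap E mul0r.
Qed.
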